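(* Let $R$ be a ring, ${}'\mathcal{C}={}'\mathcal{C}_R$ and $\mathfrak{a}:=\mathrm{ass}_R({}'\mathcal{C})$. When $\mathfrak a$ is an ideal of $R$, let $\overline{R}:=R/\mathfrak{a}$, $\pi:R\to\overline{R}$, $r\mapsto r+\mathfrak{a}$, and $\overline{{}'\mathcal{C}}:=\pi({}'\mathcal{C})$. The following statements are equivalent. 1. ${}'Q:={}'Q_{l,\mathrm{cl}}(R)$ is a semisimple Artinian ring. 2. (a) $\mathfrak{a}$ is a semiprime ideal of $R$; (b) the set $\overline{{}'\mathcal{C}}$ is a dense subset of ${}'\mathcal{C}_{\overline{R}}$; (c) $\mathrm{udim}({}_{\overline{R}}\overline{R})<\infty$; and (d) ${}'\mathcal{C}_V\neq\emptyset$ for all uniform left ideals $V$ of $\overline{R}$. 3. $\mathfrak{a}$ is a semiprime ideal of $R$, $\overline{{}'\mathcal{C}}$ is a dense subset of $\mathcal{C}_{\overline{R}}$, and $Q_{l,\mathrm{cl}}(\overline{R})$ is a semisimple Artinian ring. If one of the equivalent conditions holds then $\overline{{}'\mathcal{C}}\in\mathrm{Den}_l(\overline{R},0)$, $\overline{{}'\mathcal{C}}$ is a dense subset of $\mathcal{C}_{\overline{R}}$ and ${}'Q\simeq\overline{{}'\mathcal{C}}^{\,-1}\overline{R}\simeq Q_{l,\mathrm{cl}}(\overline{R})$. Furthermore, the ring ${}'Q$ is a simple ring if and only if the ideal $\mathfrak{a}$ is a prime ideal.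
   Context: Rings are associative with $1$. For a nonempty subset $S$ of a ring $R$, $\mathrm{ass}_R(S):=\{r\in R\mid sr=0\text{ for some }s\in S\}$. ${}'\mathcal{C}_R$ is the set of left regular elements of $R$: those $r\in R$ such that $xr=0$ ($x\in R$) implies $x=0$. $\mathcal{C}_R$ is the set of regular elements: those $r$ such that $xr=0$ implies $x=0$ and $rx=0$ implies $x=0$. For a left ideal $I$ of $R$, ${}'\mathcal{C}_I:=\{i\in I\mid I\to I,\ x\mapsto xi,\text{ is injective}\}$. A multiplicative set is a subset $S$ with $1\in S$, $SS\subseteq S$, $0\notin S$. It is a left Ore set if for all $r\in R$, $s\in S$ one has $Sr\cap Rs\neq\emptyset$. It is a left denominator set if it is left Ore and $rs=0$ with $r\in R$, $s\in S$ implies $r\in\mathrm{ass}_R(S)$; then $\mathrm{ass}_R(S)$ is an ideal and the left localization $S^{-1}R$ exists. $\mathrm{Den}_l(R,I)$ is the set of left denominator sets $S$ with $\mathrm{ass}_R(S)=I$. For multiplicative sets $S\subseteq T$ of $R$, $S$ is dense in $T$ if for each $t\in T$ there is $r\in R$ with $rt\in S$. ${}'Q_{l,\mathrm{cl}}(R):={}'\mathcal{C}_R^{-1}R$ and $Q_{l,\mathrm{cl}}(R):=\mathcal{C}_R^{-1}R$; these exist exactly when ${}'\mathcal{C}_R$, respectively $\mathcal{C}_R$, is a left denominator set, and an assertion that such a ring has a property includes the assertion that it exists. A nonzero module is uniform if any two of its nonzero submodules have nonzero intersection; a uniform left ideal is a left ideal that is uniform as a left module. $\mathrm{udim}({}_RR)<\infty$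 means that there are finitely many uniform left ideals of $R$ whose sum is direct and is an essential left ideal of $R$. *)

(* Defs.v *)
From HB Require Import structures.
From mathcomp Require Import all_boot all_order all_algebra.
From mathcomp Require Import boolp classical_sets.
Set Implicit Arguments.
Unset Strict Implicit.
Unset Printing Implicit Defensive.
Import GRing.Theory.
Local Open Scope classical_set_scope.
Local Open Scope ring_scope.
Local Open Scope quotient_scope.

(* [pzRingType] is the library's type of associative unital rings, the zero
   ring included. *)

(* ** Ideals *)

Definition is_left_ideal (R : pzRingType) (L : set R) : Prop :=
  [/\ L 0, forall x y, L x -> L y -> L (x + y)
    & forall r x, L x -> L (r * x)].

Definition is_ideal (R : pzRingType) (I : set R) : Prop :=
  is_left_ideal I /\ forall r x, I x -> I (x * r).

(* Since [I] is closed under addition, [A B] is contained in [I] as soon as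
   all products [a * b] are. *)
Definition semiprime_ideal (R : pzRingType) (I : set R) : Prop :=
  is_ideal I /\
  forall A : set R, is_ideal A ->
    (forall x y, A x -> A y -> I (x * y)) -> A `<=` I.

Definition prime_ideal (R : pzRingType) (I : set R) : Prop :=
  [/\ is_ideal I, ~ I 1
    & forall A B : set R, is_ideal A -> is_ideal B ->
        (forall x y, A x -> B y -> I (x * y)) -> A `<=` I \/ B `<=` I].

Definition simple_ring (R : pzRingType) : Prop :=
  (1 : R) <> 0 /\
  forall I : set R, is_ideal I -> I = [set 0] \/ I = [set: R].

Definition left_artinian (R : pzRingType) : Prop :=
  forall L : nat -> set R,
    (forall n, is_left_ideal (L n)) -> (forall n, L n.+1 `<=` L n) ->
    exists N, forall n, (N <= n)%N -> L n = L N.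

(* The left module [R] over [R] is semisimple: all submodules are direct
   summands. *)
Definition left_semisimple (R : pzRingType) : Prop :=
  forall L : set R, is_left_ideal L ->
    exists M : set R, [/\ is_left_ideal M, L `&` M = [set 0]
      & forall r, exists x y, [/\ L x, M y & r = x + y]].

Definition semisimple_artinian (R : pzRingType) : Prop :=
  left_semisimple R /\ left_artinian R.

(* ** Uniform left ideals and uniform dimension *)

Definition nonzero (R : pzRingType) (L : set R) : Prop :=
  exists x, L x /\ x <> 0.

Definition uniform_left_ideal (R : pzRingType) (V : set R) : Prop :=
  [/\ is_left_ideal V, nonzero V
    & forall L M : set R, is_left_ideal L -> is_left_ideal M ->
        L `<=` V -> M `<=` V -> nonzero L -> nonzero M -> nonzero (L `&` M)].

Definition sum_set (R : pzRingType) (n : nat) (V : 'I_n -> set R) : set R :=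
  [set r | exists x : 'I_n -> R, (forall i, V i (x i)) /\ r = \sum_i x i].

Definition direct_family (R : pzRingType) (n : nat) (V : 'I_n -> set R) : Prop :=
  forall x : 'I_n -> R, (forall i, V i (x i)) -> \sum_i x i = 0 ->
    forall i, x i = 0.

Definition essential_left_ideal (R : pzRingType) (E : set R) : Prop :=
  is_left_ideal E /\
  forall L : set R, is_left_ideal L -> nonzero L -> nonzero (E `&` L).

Definition finite_left_udim (R : pzRingType) : Prop :=
  exists (n : nat) (V : 'I_n -> set R),
    [/\ forall i, uniform_left_ideal (V i), direct_family V
      & essential_left_ideal (sum_set V)].

(* ** Regular elements *)

(* ['C_R]: right multiplication by [r] is injective, i.e. [r] is [GRing.rreg]. *)
Definition left_regular (R : pzRingType) : set R :=
  [set r | forall x : R, x * r = 0 -> x = 0].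

Definition regular (R : pzRingType) : set R :=
  [set r | (forall x : R, x * r = 0 -> x = 0) /\
           (forall x : R, r * x = 0 -> x = 0)].

Arguments left_regular R : clear implicits.
Arguments regular R : clear implicits.

(* ['C_I] for a left ideal [I] *)
Definition left_regular_in (R : pzRingType) (I : set R) : set R :=
  [set i | I i /\ forall x y : R, I x -> I y -> x * i = y * i -> x = y].

(* ** Ore localization *)

Definition ass (R : pzRingType) (S : set R) : set R :=
  [set r | exists2 s, S s & s * r = 0].

Definition multiplicative_set (R : pzRingType) (S : set R) : Prop :=
  [/\ S 1, forall s t, S s -> S t -> S (s * t) & ~ S 0].

Definition left_ore_set (R : pzRingType) (S : set R) : Prop :=
  multiplicative_set S /\
  forall r s : R, S s -> exists s' r' : R, S s' /\ s' * r = r' * s.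

Definition left_denominator_set (R : pzRingType) (S : set R) : Prop :=
  left_ore_set S /\ forall r s : R, S s -> r * s = 0 -> ass S r.

(* [Den_l(R, I)] *)
Definition left_den (R : pzRingType) (I : set R) : set (set R) :=
  [set S | left_denominator_set S /\ ass S = I].

Definition dense_subset (R : pzRingType) (S T : set R) : Prop :=
  [/\ multiplicative_set S, multiplicative_set T, S `<=` T
    & forall t, T t -> exists r : R, S (r * t)].

Definition invertible (R : pzRingType) (x : R) : Prop :=
  exists y : R, y * x = 1 /\ x * y = 1.

(* [Q], with the structure map [f : R -> Q], is the left localization
   [S^-1 R] of [R] at the left denominator set [S]: the elements of [S] become
   invertible, every element of [Q] is a left fraction [f(s)^-1 f(r)] (written
   without inverses), and [f] has kernel [ass S]. *)
Definition is_left_localization (R : pzRingType) (S : set R)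
    (Q : pzRingType) (f : {rmorphism R -> Q}) : Prop :=
  [/\ left_denominator_set S,
      forall s, S s -> invertible (f s),
      forall q : Q, exists s r : R, S s /\ f s * q = f r
    & forall r : R, f r = 0 <-> ass S r].

(* [S^-1 R] exists and has the property [P]. *)
Definition left_localization_has (R : pzRingType) (S : set R)
    (P : pzRingType -> Prop) : Prop :=
  exists (Q : pzRingType) (f : {rmorphism R -> Q}),
    is_left_localization S f /\ P Q.

Definition ring_isomorphic (A B : pzRingType) : Prop :=
  exists f : {rmorphism A -> B}, bijective f.

(* ** The quotient ring by a two-sided ideal *)

(* The library's quotient [Quotient.quot] is a ring only in the commutative,
   proper case; its additive group is equipped here with the multiplication
   for an arbitrary two-sided ideal, given as a proof of [is_ideal I]. *)

Section QuotientRing.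
Variables (R : pzRingType) (I : set R) (hI : is_ideal I).

(* [hI] is a parameter so that the instance below can be inferred. *)
Definition ideal_mem (_ : is_ideal I) (x : R) : bool := `[< I x >].

Lemma ideal_mem_zmod : zmod_closed (ideal_mem hI).
Proof.
have [[I0 ID IM] _] := hI; split; first exact/asboolP.
move=> x y /asboolP Ix /asboolP Iy; apply/asboolP.
by apply: ID => //; rewrite -mulN1r; apply: IM.
Qed.

HB.instance Definition _ :=
  GRing.isZmodClosed.Build R (ideal_mem hI) ideal_mem_zmod.

Definition ideal_closed : zmodClosed R :=
  GRing.ZmodClosed.clone R (ideal_mem hI) _.

Definition quot_ring : Type := Quotient.quot ideal_closed.

HB.instance Definition _ := GRing.Zmodule.on quot_ring.

Definition quot_map (x : R) : quot_ring :=
  \pi_(Quotient.quot ideal_closed) x.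

Lemma quot_map_eq x y : quot_map x = quot_map y <-> I (x - y).
Proof.
rewrite /quot_map; split.
  by move/eqP; rewrite -Quotient.idealrBE => /asboolP.
by move=> h; apply/eqP; rewrite -Quotient.idealrBE; apply/asboolP.
Qed.

Lemma quot_map_surj (q : quot_ring) : exists x, quot_map x = q.
Proof. by exists (repr q); rewrite /quot_map reprK. Qed.

Lemma quot_mapB : zmod_morphism quot_map.
Proof. by move=> x y; rewrite /quot_map !piE. Qed.

HB.instance Definition _ :=
  GRing.isZmodMorphism.Build R quot_ring quot_map quot_mapB.

Definition quot_one : quot_ring := quot_map 1.
Definition quot_mul (p q : quot_ring) : quot_ring :=
  quot_map (repr p * repr q).

Lemma quot_mapM x y : quot_map (x * y) = quot_mul (quot_map x) (quot_map y).
Proof.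
have rK z : I (z - repr (quot_map z)).
  by apply/quot_map_eq; rewrite /quot_map reprK.
apply/quot_map_eq; have [[_ ID IMl] IMr] := hI.
set x' := repr _; set y' := repr _.
have -> : x * y - x' * y' = x * (y - y') + (x - x') * y'.
  by rewrite mulrBr mulrBl addrA subrK.
by apply: ID; [apply/IMl/rK | apply/IMr/rK].
Qed.

Lemma quot_mulA : associative quot_mul.
Proof.
move=> p q r; have [x <-] := quot_map_surj p; have [y <-] := quot_map_surj q.
by have [z <-] := quot_map_surj r; rewrite -!quot_mapM mulrA.
Qed.

Lemma quot_mul1l : left_id quot_one quot_mul.
Proof.
by move=> p; have [x <-] := quot_map_surj p; rewrite -quot_mapM mul1r.
Qed.

Lemma quot_mul1r : right_id quot_one quot_mul.
Proof.
by move=> p; have [x <-] := quot_map_surj p; rewrite -quot_mapM mulr1.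
Qed.

Lemma quot_mulDl : left_distributive quot_mul +%R.
Proof.
move=> p q r; have [x <-] := quot_map_surj p; have [y <-] := quot_map_surj q.
have [z <-] := quot_map_surj r.
by rewrite -!quot_mapM -!raddfD -quot_mapM mulrDl.
Qed.

Lemma quot_mulDr : right_distributive quot_mul +%R.
Proof.
move=> p q r; have [x <-] := quot_map_surj p; have [y <-] := quot_map_surj q.
have [z <-] := quot_map_surj r.
by rewrite -!quot_mapM -!raddfD -quot_mapM mulrDr.
Qed.

HB.instance Definition _ := GRing.Zmodule_isPzRing.Build quot_ring
  quot_mulA quot_mul1l quot_mul1r quot_mulDl quot_mulDr.

Lemma quot_map_monoid : monoid_morphism quot_map.
Proof. by split=> // x y; rewrite quot_mapM. Qed.

HB.instance Definition _ :=
  GRing.isMonoidMorphism.Build R quot_ring quot_map quot_map_monoid.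

End QuotientRing.

Arguments quot_ring {R I} hI.
Arguments quot_map {R I} hI x.

(* Main.v *)
Require Import Defs.
From HB Require Import structures.
From mathcomp Require Import all_boot all_order all_algebra.
From mathcomp Require Import boolp classical_sets.
Set Implicit Arguments.
Unset Strict Implicit.
Unset Printing Implicit Defensive.
Import GRing.Theory.
Local Open Scope classical_set_scope.
Local Open Scope ring_scope.

(** Let [C] be the set of left regular elements of [R], [a = ass C] and
    [T = R / a]. A localization of [R] at [C] kills exactly [a], so that it is
    the same thing as a localization of [T] at the image [C'] of [C], in which
    [T] is a subring ([localization_of_quotient],
    [quotient_of_localization]). This reduces everything to left orders in
    semisimple Artinian rings, that is, to Goldie's theorem for [T].

    From 1 to 2. Let [Q] be semisimple Artinian with [T] in [Q]. A left regular
    element of [T] stays left regular in [Q] and hence is a unit there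
    ([left_regular_fraction_unit]); writing its inverse as a left fraction
    shows that [C'] is dense ([dense_left_regular]). The extension [Q I] of an
    ideal [I] of [T] is an ideal of [Q] because [Q] is Artinian
    ([ideal_extension]), so nilpotent ideals of [T] would give nilpotent ideals
    of [Q] ([semiprime_ass]). The decomposition of [Q] into minimal left ideals
    restricts to an independent family of uniform left ideals of [T] whose sum
    is essential ([finite_udim_localization]). Finally, if [V] is uniform,
    then an element [v] of [V] with [V v <> 0] is left regular on [V]
    ([left_regular_in_uniform]).

    From 2 to 3. If [T] has finite uniform dimension and every uniform left
    ideal [V] has an element that is left regular on [V], then every essential
    left ideal contains a left regular element: it is assembled from elements
    of uniform left ideals, one uniform summand at a time
    ([uniform_sum_left_regular]). Conversely, a left regular [c] generates an
    essential left ideal, as otherwise the [x c^k] would be an infinite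
    independent sequence ([left_regular_essential]). It follows that left
    regular elements are regular ([left_regular_regular]) and form a left Ore
    set ([regular_left_ore]). The ring of fractions [Q] is then constructed
    ([ore_localization]). A left ideal of [Q] is complemented, because its
    preimage in [T] is complemented up to an essential left ideal, which
    contains a unit of [Q] ([classical_quotient_semisimple]). A strictly
    decreasing chain in [Q] would again give an infinite independent sequence
    in [T] ([classical_quotient_artinian]).

    From 3 to 1. Since [C'] is dense in the regular elements of [T], both sets
    have the same localizations ([localization_dense]).

    The isomorphisms hold because a localization is determined up to
    isomorphism by the ring and the set ([localization_unique]). The
    correspondence between the ideals of [R] and of [Q] gives the criterion for
    simplicity ([simple_localizationP]). *)

(** * Left ideals and essential left ideals *)

Section LeftIdeals.
Variable R : pzRingType.
Implicit Types (L M W V E : set R) (x y c : R).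

Lemma left_idealN L : is_left_ideal L -> forall x, L x -> L (- x).
Proof. by case=> _ _ hM x Lx; rewrite -mulN1r; apply: hM. Qed.

Lemma left_idealB L : is_left_ideal L -> forall x y, L x -> L y -> L (x - y).
Proof.
move=> hL x y Lx Ly; case: (hL) => _ hD _.
by apply: hD => //; apply: left_idealN.
Qed.

Definition principal x : set R := [set y | exists r, y = r * x].

Definition ideal_sum L M : set R :=
  [set z | exists x y, [/\ L x, M y & z = x + y]].

Definition left_ann x : set R := [set r | r * x = 0].

Lemma left_ideal0 : is_left_ideal ([set 0] : set R).
Proof.
by split=> //= [x y -> ->|r x ->]; rewrite ?addr0 ?mulr0.
Qed.

Lemma left_ideal_principal x : is_left_ideal (principal x).
Proof.
split=> [|_ _ [r ->] [s ->]|s _ [r ->]]; first by exists 0; rewrite mul0r.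
  by exists (r + s); rewrite mulrDl.
by exists (s * r); rewrite mulrA.
Qed.

Lemma principal_sub L x : is_left_ideal L -> L x -> principal x `<=` L.
Proof. by case=> _ _ hM Lx _ [r ->]; apply: hM. Qed.

Lemma mem_principal x : principal x x.
Proof. by exists 1; rewrite mul1r. Qed.

Lemma left_idealI L M :
  is_left_ideal L -> is_left_ideal M -> is_left_ideal (L `&` M).
Proof.
move=> [L0 LD LM] [M0 MD MM]; split=> // [x y [] ? ? [] ? ?|r x [] ? ?].
  by split; [apply: LD | apply: MD].
by split; [apply: LM | apply: MM].
Qed.

Lemma left_ideal_sum L M :
  is_left_ideal L -> is_left_ideal M -> is_left_ideal (ideal_sum L M).
Proof.
move=> [L0 LD LM] [M0 MD MM]; split.
- by exists 0, 0; rewrite addr0.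
- move=> _ _ [x [y [Lx My ->]]] [x' [y' [Lx' My' ->]]].
  by exists (x + x'), (y + y'); split; [apply: LD|apply: MD|rewrite addrACA].
- move=> r _ [x [y [Lx My ->]]]; exists (r * x), (r * y).
  by split; [apply: LM|apply: MM|rewrite mulrDr].
Qed.

Lemma sub_ideal_suml L M : is_left_ideal M -> L `<=` ideal_sum L M.
Proof. by case=> M0 _ _ x Lx; exists x, 0; rewrite addr0. Qed.

Lemma sub_ideal_sumr L M : is_left_ideal L -> M `<=` ideal_sum L M.
Proof. by case=> L0 _ _ x Mx; exists 0, x; rewrite add0r. Qed.

Lemma left_ideal_ann x : is_left_ideal (left_ann x).
Proof.
split=> [|r s|s r] /=; rewrite /left_ann /= ?mul0r //.
  by move=> hr hs; rewrite mulrDl hr hs addr0.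
by move=> hr; rewrite -mulrA hr mulr0.
Qed.

Lemma left_ideal_colon L y :
  is_left_ideal L -> is_left_ideal [set r | L (r * y)].
Proof.
case=> L0 LD LM; split=> /= [|r s|s r]; rewrite ?mul0r // ?mulrDl -?mulrA.
  exact: LD.
exact: LM.
Qed.

Lemma nonzero_principal x : x <> 0 -> nonzero (principal x).
Proof. by exists x; split=> //; apply: mem_principal. Qed.

Lemma not_nonzero L : ~ nonzero L -> L `<=` [set 0].
Proof. by move=> nL x Lx; apply: contrapT => x0; apply: nL; exists x. Qed.

Lemma essentialP E : essential_left_ideal E <->
  is_left_ideal E /\ forall x, x <> 0 -> exists r, E (r * x) /\ r * x <> 0.
Proof.
split=> -[hE H]; split=> //.
  move=> x x0.
  have [y [[Ey [r yE]] y0]] :=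
    H _ (left_ideal_principal x) (nonzero_principal x0).
  by exists r; rewrite -yE.
move=> L [_ _ LM] [x [Lx x0]]; have [r [Er r0]] := H x x0.
by exists (r * x); split=> //; split=> //; apply: LM.
Qed.

(** Right multiplication by [y] pulls essential left ideals back to essential
    left ideals: where [x * y] vanishes there is nothing to ask for. *)
Lemma essential_colon E y :
  essential_left_ideal E -> essential_left_ideal [set r | E (r * y)].
Proof.
move=> /essentialP [hE H]; apply/essentialP; split; first exact: left_ideal_colon.
move=> x x0 /=; have [xy0|xy0] := pselect (x * y = 0).
  by exists 1; rewrite mul1r xy0; split=> //; case: hE.
have [r [Er r0]] := H _ xy0; exists r; rewrite -mulrA; split=> // rx0.
by apply: r0; rewrite mulrA rx0 mul0r.
Qed.

Lemma uniform_common_multiple V x y : uniform_left_ideal V ->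
  V x -> V y -> x <> 0 -> y <> 0 -> exists r s, r * x = s * y /\ r * x <> 0.
Proof.
move=> [hV _ H] Vx Vy x0 y0.
have [z [[[r zr] [s zs]] z0]] := H _ _ (left_ideal_principal x)
  (left_ideal_principal y) (principal_sub hV Vx) (principal_sub hV Vy)
  (nonzero_principal x0) (nonzero_principal y0).
by exists r, s; rewrite -zr -zs.
Qed.

(** A left ideal of [W + V] that misses [W] projects injectively to [V]. *)
Lemma uniform_sum_complement W V L :
  is_left_ideal W -> uniform_left_ideal V -> W `&` V `<=` [set 0] ->
  is_left_ideal L -> nonzero L -> L `<=` ideal_sum W V ->
  L `&` W `<=` [set 0] -> uniform_left_ideal L.
Proof.
move=> hW uV WV hL nL LWV LW; split=> // M N hM hN ML NL.
move=> [x [Mx x0]] [y [Ny y0]].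
have [w [v [Ww Vv xE]]] := LWV _ (ML _ Mx).
have [w' [v' [Ww' Vv' yE]]] := LWV _ (NL _ Ny).
have v0 : v <> 0.
  by move=> v0; apply/x0/LW; split; [exact: ML | rewrite xE v0 addr0].
have v'0 : v' <> 0.
  by move=> v'0; apply/y0/LW; split; [exact: NL | rewrite yE v'0 addr0].
have [r [s [rsE rv0]]] := uniform_common_multiple uV Vv Vv' v0 v'0.
have [_ _ hLM] := hL; have [hV _ _] := uV; have [_ _ hWM] := hW.
have rx_sy : r * x = s * y.
  apply/eqP; rewrite -subr_eq0; apply/eqP/LW; split.
    by apply: left_idealB => //; apply: hLM; [apply: ML|apply: NL].
  rewrite xE yE !mulrDr rsE opprD addrACA subrr addr0.
  by apply: left_idealB => //; apply: hWM.
exists (r * x); split; first split.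
- by case: hM => _ _; apply.
- by rewrite rx_sy; case: hN => _ _; apply.
move=> rx0; apply/rv0/WV; split; last by case: hV => _ _; apply.
have -> : r * v = - (r * w) by apply/eqP; rewrite -addr_eq0 addrC -mulrDr -xE rx0.
by apply: left_idealN => //; apply: hWM.
Qed.

End LeftIdeals.

(** * Finite uniform dimension *)

(** The sums of finitely many independent uniform left ideals, built up one
    summand at a time so that facts about them can be proved by induction. *)
Inductive uniform_sum (R : pzRingType) : set R -> Prop :=
| uniform_sum0 : uniform_sum [set 0]
| uniform_sumS W V : uniform_sum W -> uniform_left_ideal V ->
    W `&` V `<=` [set 0] -> uniform_sum (ideal_sum W V).

Section UniformDimension.
Variable R : pzRingType.
Implicit Types (L M W V E : set R) (x y c : R).

Lemma uniform_sum_left_ideal W : uniform_sum W -> is_left_ideal W.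
Proof.
elim=> [|{}W V _ hW [hV _ _] _]; first exact: left_ideal0.
exact: left_ideal_sum.
Qed.

Definition cons_family n (V : 'I_n -> set R) V0 (i : 'I_n.+1) : set R :=
  oapp V V0 (unlift ord0 i).

Lemma sum_set_recl n (V : 'I_n.+1 -> set R) :
  sum_set V = ideal_sum (sum_set (fun i => V (lift ord0 i))) (V ord0).
Proof.
apply/seteqP; split=> z.
  move=> [x [Vx ->]]; rewrite big_ord_recl addrC.
  exists (\sum_(i < n) x (lift ord0 i)), (x ord0); split=> //.
  by exists (fun i => x (lift ord0 i)).
move=> [_ [x0 [[x [Vx ->]] Vx0 ->]]].
exists (fun i => oapp x x0 (unlift ord0 i)); split=> [i|].
  by case: (unliftP ord0 i) => [j|] ->.
rewrite big_ord_recl unlift_none addrC; congr (_ + _).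
by apply: eq_bigr => i _; rewrite liftK.
Qed.

Lemma finite_left_udimP : finite_left_udim R <->
  exists2 W : set R, uniform_sum W & essential_left_ideal W.
Proof.
split.
  move=> [n [V [uV dV eV]]]; exists (sum_set V) => //.
  elim: n V uV dV {eV} => [|n IH] V uV dV.
    suff -> : sum_set V = [set 0] by exact: uniform_sum0.
    apply/seteqP; split=> z /=; first by move=> [x [_ ->]]; rewrite big_ord0.
    by move=> ->; exists (fun=> 0); rewrite big_ord0; split=> // -[].
  (* a sum [y] of tail entries that lies in the head [V ord0] is a relation in
     the whole family, with the entry [- y] at the head *)
  have dtail (x : 'I_n -> R) y : (forall i, V (lift ord0 i) (x i)) -> V ord0 y ->
      \sum_i x i = y -> y = 0 /\ forall i, x i = 0.
    move=> Vx Vy xy; pose z i := oapp x (- y) (unlift ord0 i).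
    have Vz i : V i (z i).
      rewrite /z; case: (unliftP ord0 i) => [j|] -> //=.
      by apply: left_idealN => //; case: (uV ord0).
    have z0 : \sum_i z i = 0.
      rewrite big_ord_recl /z unlift_none /= addrC; apply/eqP.
      rewrite subr_eq0 -xy; apply/eqP/eq_bigr => i _.
      by rewrite liftK.
    have zE := dV z Vz z0; split=> [|i].
      by apply/eqP; have := zE ord0; rewrite /z unlift_none /= -oppr_eq0 => ->.
    by have := zE (lift ord0 i); rewrite /z liftK.
  rewrite sum_set_recl; apply: uniform_sumS => //.
    apply: IH => // x Vx x0; apply: (dtail x 0 Vx _ x0).2.
    by case: (uV ord0) => -[].
  by move=> z [[x [Vx xE]] Vz]; apply: (dtail x z Vx Vz _).1.
move=> [W + eW].
suff H (U : set R) : uniform_sum U -> exists n (V : 'I_n -> set R),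
    [/\ forall i, uniform_left_ideal (V i), direct_family V & sum_set V = U].
  by move=> /H [n [V [uV dV VW]]]; exists n, V; rewrite VW.
elim=> [|{eW}W' V0 _ [n [V [uV dV VW]]] uV0 WV0].
  exists 0%N, (fun=> setT); split=> [[]//|x _ _ []//|].
  apply/seteqP; split=> z /=; first by move=> [x [_ ->]]; rewrite big_ord0.
  by move=> ->; exists (fun=> 0); rewrite big_ord0; split=> // -[].
have consE : (fun i => cons_family V V0 (lift ord0 i)) = V.
  by apply/funext => i; rewrite /cons_family liftK.
have cons0 : cons_family V V0 ord0 = V0 by rewrite /cons_family unlift_none.
exists n.+1, (cons_family V V0); split.
- by move=> i; rewrite /cons_family; case: (unliftP ord0 i) => /=.
- move=> x Vx; rewrite big_ord_recl => x0.
  have Vx' i : V i (x (lift ord0 i)).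
    by have := Vx (lift ord0 i); rewrite /cons_family liftK.
  have xt0 : x ord0 = 0.
    have [hV0 _ _] := uV0; apply/WV0; split; last by have := Vx ord0; rewrite cons0.
    have -> : x ord0 = - \sum_(i < n) x (lift ord0 i).
      by apply/eqP; rewrite -addr_eq0 x0.
    rewrite -VW; exists (fun i => - x (lift ord0 i)); rewrite sumrN; split=> // i.
    by apply: left_idealN => //; case: (uV i).
  move: x0; rewrite xt0 add0r => x0 i.
  case: (unliftP ord0 i) => [j|] -> //.
  exact: (dV _ Vx' x0 j).
- by rewrite sum_set_recl consE VW cons0.
Qed.

(** The left ideals [R * x k] form a direct sum; the [x k] may be zero. *)
Definition independent (x : nat -> R) : Prop :=
  forall n (t : nat -> R), \sum_(k < n) t k * x k = 0 ->
    forall k, (k < n)%N -> t k * x k = 0.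

Lemma independent_scale (x r : nat -> R) :
  independent x -> independent (fun k => r k * x k).
Proof.
move=> ix n t t0 k kn; rewrite mulrA.
apply: (ix n (fun k => t k * r k)) => //.
by rewrite -[RHS]t0; apply: eq_bigr => i _; rewrite mulrA.
Qed.

(** Gaussian elimination: in [W + V] either every [R * x k] meets [W], or some
    [x k] with [R * x k] disjoint from [W] serves as a pivot to move the later
    terms into [W]; both ways an infinite independent sequence of [W + V]
    yields one of [W]. *)
Lemma uniform_sum_independent W : uniform_sum W ->
  forall x : nat -> R, independent x -> (forall k, W (x k)) ->
  ~ (forall k, x k <> 0).
Proof.
elim=> [|{}W V sW IH uV WV] x ix Wx xn0; first by apply: (xn0 0%N); apply: Wx.
have hW := uniform_sum_left_ideal sW; have [W0 WD WM] := hW.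
have [all_meet|] := pselect (forall k, exists r, W (r * x k) /\ r * x k <> 0).
  have [r hr] := choice all_meet.
  apply: (IH (fun k => r k * x k)) => [|k|k]; [|by case: (hr k)..].
  exact: independent_scale.
move=> /existsNP [p np].
have pW t : W (t * x p) -> t * x p = 0.
  by move=> Wt; apply: contrapT => tn0; apply: np; exists t.
have [w0 [v0 [Ww0 Vv0 xpE]]] := Wx p.
have v00 : v0 <> 0.
  move=> v00; apply: (xn0 p); rewrite -[x p]mul1r; apply: pW.
  by rewrite mul1r xpE v00 addr0.
have pivot k : exists rs : R * R, W (rs.1 * x (p + k.+1)%N - rs.2 * x p) /\
    rs.1 * x (p + k.+1)%N <> 0.
  have [[r [Wr rn0]]|nm] :=
    pselect (exists r, W (r * x (p + k.+1)%N) /\ r * x (p + k.+1)%N <> 0).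
    by exists (r, 0); rewrite /= mul0r subr0.
  have [w [v [Ww Vv xkE]]] := Wx (p + k.+1)%N.
  have vn0 : v <> 0.
    move=> vn0; apply: nm; exists 1; rewrite mul1r; split; last exact: xn0.
    by rewrite xkE vn0 addr0.
  have [r [s [rsE rvn0]]] := uniform_common_multiple uV Vv Vv0 vn0 v00.
  exists (r, s) => /=; split.
    rewrite xkE xpE !mulrDr rsE opprD addrACA subrr addr0.
    by apply: left_idealB => //; apply: WM.
  move=> rx0; apply/rvn0/WV; split; last by case: uV => -[_ _ VM] _ _; apply: VM.
  have -> : r * v = - (r * w).
    by apply/eqP; rewrite -addr_eq0 addrC -mulrDr -xkE rx0.
  by apply: left_idealN => //; apply: WM.
have [rs hrs] := choice pivot.
pose y k := (rs k).1 * x (p + k.+1)%N - (rs k).2 * x p.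
(* a relation among the [y k] is a relation among [x p] and later terms *)
have rel n (t : nat -> R) : \sum_(k < n) t k * y k = 0 ->
    forall k, (k < n)%N -> t k * ((rs k).1 * x (p + k.+1)%N) = 0.
  move=> t0.
  pose u j := if (j < p)%N then 0 else if j == p
    then - \sum_(k < n) t k * (rs k).2 else t (j - p.+1)%N * (rs (j - p.+1)%N).1.
  have u0 : \sum_(j < p + n.+1) u j * x j = 0.
    rewrite big_split_ord /= big1 ?add0r => [|i _]; last first.
      by rewrite /u ltn_ord mul0r.
    rewrite big_ord_recl /= {1}/u addn0 ltnn eqxx mulNr mulr_suml addrC.
    rewrite -sumrB -[RHS]t0; apply: eq_bigr => i _.
    rewrite /u /bump /= add1n ltnNge leq_addr /= -[X in _ == X]addn0 eqn_add2l /=.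
    by rewrite addnS subSS addKn -addnS /y mulrBr !mulrA.
  move=> k kn; have := ix _ _ u0 (p + k.+1)%N.
  rewrite ltn_add2l ltnS kn => /(_ isT).
  rewrite /u ltnNge leq_addr /= -[X in _ == X]addn0 eqn_add2l /=.
  by rewrite addnS subSS addKn mulrA.
apply: (IH y) => [n t t0 k kn|k|k yk0]; last 1 first.
- have := rel k.+1 (fun j => (j == k)%:R) _ k (ltnSn k).
  rewrite eqxx mul1r => relk; case: (hrs k) => _; apply; apply: relk.
  rewrite big_ord_recr /= eqxx mul1r yk0 addr0 big1 // => i _.
  by rewrite (ltn_eqF (ltn_ord i)) mul0r.
- have tk := rel n t t0 k kn; rewrite /y mulrBr tk sub0r mulrA.
  apply/eqP; rewrite oppr_eq0; apply/eqP/pW.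
  have : W (t k * y k) by apply: WM; case: (hrs k).
  by rewrite /y mulrBr tk sub0r mulrA => /(left_idealN hW); rewrite opprK.
- by case: (hrs k).
Qed.

Lemma finite_udim_independent (x : nat -> R) : finite_left_udim R ->
  independent x -> ~ (forall k, x k <> 0).
Proof.
move=> /finite_left_udimP [W sW /essentialP [hW H]] ix xn0.
have [r hr] := choice (fun k => H (x k) (xn0 k)).
apply: (uniform_sum_independent sW (x := fun k => r k * x k)) => [|k|k];
  [|by case: (hr k)..].
exact: independent_scale.
Qed.
End UniformDimension.

(** * Regular elements *)

Section Goldie.
Variable R : pzRingType.
Implicit Types (L M W V E : set R) (x y c : R).

(** At the first partial sum that [L] meets, [L] meets it in a left ideal that
    misses the sums before; such a left ideal is uniform. *)
Lemma uniform_sum_contains_uniform W : uniform_sum W ->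
  forall L, is_left_ideal L -> nonzero L -> L `<=` W ->
  exists2 V, uniform_left_ideal V & V `<=` L.
Proof.
elim=> [|{}W V sW IH uV WV] L hL nL LW.
  by case: nL => x [Lx x0]; case: x0; apply: LW.
have hW := uniform_sum_left_ideal sW.
have [nLW|/not_nonzero LW0] := pselect (nonzero (L `&` W)).
  have [U uU ULW] := IH _ (left_idealI hL hW) nLW (@subIsetr _ L W).
  by exists U => // x /ULW [].
by exists L => //; apply: (uniform_sum_complement hW uV).
Qed.

Hypothesis regular_in_uniform :
  forall V, uniform_left_ideal V -> left_regular_in V !=set0.

(** If [c] is found for [W], then [L], the part of its left annihilator inside
    [E] and [W + V], misses [W]; so [L] is uniform, unless it is zero, and one
    adds to [c] an element [a] of [L] that is left regular on [L]. When
    [x * (c + a) = 0], the element [x * c = - x * a] of [W] lies in [L], hence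
    is zero: nothing but [L] has to be killed, and [a] does so. *)
Lemma uniform_sum_left_regular E W : essential_left_ideal E ->
  uniform_sum W ->
  exists c, [/\ E c, W c & forall x, W x -> x * c = 0 -> x = 0].
Proof.
move=> eE; have [hE HE] := (essentialP E).1 eE; have [E0 ED EM] := hE.
elim=> [|{}W V sW [c [Ec Wc cW]] uV WV].
  by exists 0; split=> // x -> _.
have hW := uniform_sum_left_ideal sW; have hV : is_left_ideal V by case: uV.
have hWV := left_ideal_sum hW hV.
have WWV := @sub_ideal_suml _ W V hV.
pose L := left_ann c `&` (ideal_sum W V `&` E).
have hL : is_left_ideal L.
  by apply: left_idealI (left_ideal_ann c) (left_idealI hWV hE).
have inL x : ideal_sum W V x -> x * c = 0 -> (forall r, L (r * x) -> r * x = 0) ->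
    x = 0.
  move=> Wx xc0 H; apply: contrapT => /HE [r [Er]]; apply; apply: H.
  split; first by rewrite /left_ann /= -mulrA xc0 mulr0.
  by split=> //; case: hWV => _ _; apply.
have [nL|/not_nonzero L0] := pselect (nonzero L); last first.
  by exists c; split=> // [|x Wx xc0]; [exact: WWV | apply: inL => // r /L0].
have LW0 : L `&` W `<=` [set 0] by move=> x [[xc0 _] Wx]; apply: cW.
have uL : uniform_left_ideal L.
  by apply: (uniform_sum_complement hW uV) => // x [_ []].
have [a [La aL]] := regular_in_uniform uL; have [ac0 [Wa Ea]] := La.
exists (c + a); split=> [||x Wx]; first exact: ED.
  by case: hWV => _ WVD _; apply: WVD => //; apply: WWV.
rewrite mulrDr => /eqP; rewrite addr_eq0 => /eqP xca.
have xc0 : x * c = 0.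
  apply: LW0; split; last by case: hW => _ _; apply.
  by rewrite xca; apply: left_idealN => //; case: hL => _ _; apply.
have xa0 : x * a = 0 by apply/eqP; rewrite -oppr_eq0 -xca xc0.
apply: (inL x Wx xc0) => r Lrx; apply: aL => //; first by case: hL.
by rewrite mul0r -mulrA xa0 mulr0.
Qed.

Hypothesis udimR : finite_left_udim R.

Lemma essential_left_regular E :
  essential_left_ideal E -> exists2 c, E c & left_regular R c.
Proof.
move=> eE; have [W sW /essentialP [_ HW]] := (finite_left_udimP R).1 udimR.
have [c [Ec Wc cW]] := uniform_sum_left_regular eE sW.
exists c => // x xc0; apply: contrapT => /HW [r [Wrx]]; apply.
by apply: cW => //; rewrite -mulrA xc0 mulr0.
Qed.

(** If [x] is not zero and [R * x] misses [R * c], then the elements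
    [x * c ^+ k] are independent. *)
Lemma left_regular_essential c :
  left_regular R c -> essential_left_ideal (principal c).
Proof.
move=> rc; apply/essentialP; split; first exact: left_ideal_principal.
move=> x x0; apply: contrapT => H.
have miss r : principal c (r * x) -> r * x = 0.
  by move=> crx; apply: contrapT => rx0; apply: H; exists r.
apply: (finite_udim_independent (x := fun k => x * c ^+ k) udimR).
  elim=> [//|n IH] t; rewrite big_ord_recl expr0 mulr1 => t0.
  have tail : \sum_(i < n) t (lift ord0 i) * (x * c ^+ lift ord0 i) =
              (\sum_(i < n) t i.+1 * (x * c ^+ i)) * c.
    rewrite mulr_suml; apply: eq_bigr => i _.
    by rewrite /= /bump /= add1n exprSr !mulrA.
  have tx0 : t 0%N * x = 0.
    apply: miss; exists (- \sum_(i < n) t i.+1 * (x * c ^+ i)).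
    by apply/eqP; rewrite mulNr -tail -addr_eq0 t0.
  move: t0; rewrite tx0 add0r tail => /rc t0 [_|k kn].
    by rewrite expr0 mulr1.
  rewrite exprSr mulrA mulrA -(mulrA (t _)).
  by rewrite (IH (fun k => t k.+1) t0 k kn) mul0r.
elim=> [|k IH]; first by rewrite expr0 mulr1.
by rewrite exprSr mulrA => /rc.
Qed.

(** The left singular ideal is zero: otherwise it contains a uniform left ideal
    [V], and an element left regular on [V] has no annihilator in [V]. *)
Lemma left_nonsingular x : essential_left_ideal (left_ann x) -> x = 0.
Proof.
move=> ex; apply: contrapT => x0.
have [W sW /essentialP [hW HW]] := (finite_left_udimP R).1 udimR.
have [r [Wrx rx0]] := HW x x0.
have [V uV Vrx] := uniform_sum_contains_uniform sW
  (left_ideal_principal (r * x)) (nonzero_principal rx0) (principal_sub hW Wrx).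
have [v [Vv vV]] := regular_in_uniform uV; have [s vE] := Vrx v Vv.
have [hV nV _] := uV.
have [_ /(_ V hV nV)] := essential_colon (s * r) ex.
move=> [y [[ysr0 Vy]]]; apply; apply: vV => //; first by case: hV.
by rewrite mul0r vE -ysr0 !mulrA.
Qed.

(** If [c * x = 0], then the left annihilator of [x] contains the essential left
    ideal [R * c]. *)
Lemma left_regular_regular : left_regular R = regular R.
Proof.
apply/seteqP; split=> [c rc|c []//]; split=> // x cx0.
apply: left_nonsingular; apply/essentialP; split; first exact: left_ideal_ann.
have /essentialP [_ H] := left_regular_essential rc.
move=> y /H [r [[s rE] r0]]; exists r; split=> //.
by rewrite /left_ann /= rE -mulrA cx0 mulr0.
Qed.

Lemma essential_regular E :
  essential_left_ideal E -> exists2 c, E c & regular R c.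
Proof. by rewrite -left_regular_regular; apply: essential_left_regular. Qed.

(** The common left multiple of [r] and [s] comes from a regular element of the
    essential left ideal of those [t] with [t * r] in [R * s]. *)
Lemma regular_left_ore :
  multiplicative_set (regular R) -> left_ore_set (regular R).
Proof.
move=> mR; split=> // r s rs.
have es : essential_left_ideal (principal s).
  by apply: left_regular_essential; case: rs.
have [s' [r' E] rs'] := essential_regular (essential_colon r es).
by exists s', r'.
Qed.

(** A complement of [L] up to essentiality: a left ideal maximal among those
    that meet [L] in zero. *)
Lemma essential_complement L : is_left_ideal L -> exists M,
  [/\ is_left_ideal M, L `&` M `<=` [set 0] &
      essential_left_ideal (ideal_sum L M)].
Proof.
move=> hL; have [L0 LD LM] := hL.
(* zero is not required, so that the union of the empty chain qualifies *)
pose P M := [/\ forall x y, M x -> M y -> M (x + y),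
  forall r x, M x -> M (r * x) & L `&` M `<=` [set 0]].
have [M [[MD MM LM0] maxM]] : exists M, P M /\ forall N, M `<` N -> ~ P N.
  apply: Zorn_bigcup => F FP Ftot; split.
  - move=> x y [X FX Xx] [Y FY Yy].
    by have [XY|YX] := Ftot _ _ FX FY; [exists Y|exists X] => //;
      [case: (FP _ FY) => + _ _; apply=> //; apply: XY
      |case: (FP _ FX) => + _ _; apply=> //; apply: YX].
  - by move=> r x [X FX Xx]; exists X => //; case: (FP _ FX) => _ + _; apply.
  - by move=> x [Lx [X FX Xx]]; case: (FP _ FX) => _ _; apply.
have maximal N : P N -> M `<=` N -> N `<=` M.
  by move=> PN MN; apply: contrapT => NM; apply: (maxM N).
have M0 : M 0.
  have [[x /(MM 0)]|M_empty] := pselect (exists x, M x); first by rewrite mul0r.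
  apply: (maximal [set 0]) => // [|x Mx]; last by case: M_empty; exists x.
  by split=> [x y -> ->|r x ->|x []//]; rewrite ?addr0 ?mulr0.
have hM : is_left_ideal M by [].
exists M; split=> //; split; first exact: left_ideal_sum.
move=> X hX nX; apply: contrapT => /not_nonzero X0.
have XM : X `<=` M.
  move=> x Xx; apply: (maximal (ideal_sum M X)); last exact: sub_ideal_sumr.
    have [_ SD SM] := left_ideal_sum hM hX; split=> // z [Lz [m [y [Mm Xy zE]]]].
    have y0 : y = 0.
      apply: X0; split=> //; exists z, (- m); split=> //.
        exact: left_idealN.
      by rewrite zE addrAC subrr add0r.
    by apply: LM0; split=> //; rewrite zE y0 addr0.
  exact: sub_ideal_suml.
case: nX => x [Xx]; apply; apply: X0; split=> //.
by apply: sub_ideal_sumr => //; apply: XM.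
Qed.

End Goldie.

(** * The ring of left fractions at a left Ore set of regular elements *)

Section OreQuotient.
Variables (R : pzRingType) (S : set R).
Hypotheses (oreS : left_ore_set S) (regS : S `<=` regular R).
Implicit Types (s r c d x y z : R).

(** The graph of right multiplication by [s^-1 r], as a partial function on
    [R]: the pairs [(x, y)] with [x s^-1 r = y]. *)
Definition fraction_graph s r : set (R * R) :=
  [set p | exists c a, [/\ S c, c * p.1 = a * s & c * p.2 = a * r]].

(** A left fraction is represented by the graph of right multiplication by it.
    Equal fractions have equal graphs, so that no quotient has to be taken. The
    Ore and regularity proofs are parameters so that the ring structure below
    can be inferred from the type. *)
Definition ore_quot (_ : left_ore_set S) (_ : S `<=` regular R) : Type :=
  {G : set (R * R) | exists s r, S s /\ G = fraction_graph s r}.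

Local Notation Q := (ore_quot oreS regS).
Implicit Types p q u : Q.

(** The relation [x * q = y], before there is a product on [Q]. *)
Definition action q x y : Prop := sval q (x, y).

Let ore1 : S 1. Proof. by case: oreS => -[]. Qed.
Let oreM s c : S s -> S c -> S (s * c).
Proof. by case: oreS => -[_ + _] _; apply. Qed.
Let ore_exch r s : S s -> exists c a, S c /\ c * r = a * s.
Proof. by case: oreS => _; apply. Qed.
Let ore_lcancel c x y : S c -> c * x = c * y -> x = y.
Proof.
move=> /regS [_ H] /eqP; rewrite -subr_eq0 -mulrBr => /eqP /H /eqP.
by rewrite subr_eq0 => /eqP.
Qed.
Let ore_rcancel c x : S c -> x * c = 0 -> x = 0.
Proof. by move=> /regS [H _]; apply: H. Qed.

Lemma actionE q : exists s r, S s /\ forall x y,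
  action q x y <-> exists c a, [/\ S c, c * x = a * s & c * y = a * r].
Proof. by case: (svalP q) => s [r [Ss E]]; exists s, r; rewrite /action E. Qed.

Lemma action_base q : exists s r, S s /\ action q s r.
Proof.
have [s [r [Ss E]]] := actionE q; exists s, r; split=> //; apply/E.
by exists 1, 1; rewrite !mul1r.
Qed.

Lemma actionZ q a x y : action q x y -> action q (a * x) (a * y).
Proof.
have [s [r [Ss E]]] := actionE q => /E [c [b [Sc xE yE]]].
have [d [e [Sd de]]] := ore_exch a Sc; apply/E.
by exists d, (e * b); rewrite !mulrA de -!mulrA xE yE.
Qed.

Lemma actionD q x y x' y' :
  action q x y -> action q x' y' -> action q (x + x') (y + y').
Proof.
have [s [r [Ss E]]] := actionE q.
move=> /E [c [b [Sc xE yE]]] /E [c' [b' [Sc' xE' yE']]].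
have [d [e [Sd de]]] := ore_exch c Sc'; apply/E.
exists (d * c), (d * b + e * b'); split; first exact: oreM.
  by rewrite mulrDr mulrDl {2}de -!mulrA xE xE'.
by rewrite mulrDr mulrDl {2}de -!mulrA yE yE'.
Qed.

Lemma action_fun q x y y' : action q x y -> action q x y' -> y = y'.
Proof.
move=> xy xy'; have /actionD /(_ (actionZ (-1) xy')) := xy.
have [s [r [Ss E]]] := actionE q; rewrite !mulN1r subrr => /E [c [b [Sc]]].
rewrite mulr0 => /esym /(ore_rcancel Ss) ->; rewrite mul0r -(mulr0 c).
by move=> /(ore_lcancel Sc) /eqP; rewrite subr_eq0 => /eqP.
Qed.

Lemma action_cancel q c x y : S c -> action q (c * x) (c * y) -> action q x y.
Proof.
move=> Sc; have [s [r [Ss E]]] := actionE q => /E [d [b [Sd xE yE]]]; apply/E.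
by exists (d * c), b; rewrite -!mulrA; split=> //; apply: oreM.
Qed.

Lemma action_dom q x : exists c y, S c /\ action q (c * x) y.
Proof.
have [s [r [Ss sr]]] := action_base q; have [c [a [Sc E]]] := ore_exch x Ss.
by exists c, (a * r); rewrite E; split=> //; apply: actionZ.
Qed.

(** A fraction is determined by its action on a single element of [S]: by the
    Ore condition every [x] has a multiple in common with that element. *)
Lemma action_inj p q s y : S s -> action p s y -> action q s y -> p = q.
Proof.
move=> Ss ps qs.
suff H (p' q' : Q) : action p' s y -> action q' s y -> sval p' `<=` sval q'.
  have E : sval p = sval q by apply/seteqP; split; apply: H.
  by case: p q E {ps qs} => G hG [G' hG'] /= E; apply: eq_exist.
move=> p's q's [x z] p'x; have [c [a [Sc E]]] := ore_exch x Ss.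
apply: (action_cancel Sc); rewrite E.
have -> : c * z = a * y.
  by apply: (@action_fun p' (a * s)); [rewrite -E|]; apply: actionZ.
exact: actionZ.
Qed.

(** An [R]-stable functional relation defined at some element of [S] extends to
    a left fraction. This is the source of all elements and operations below. *)
Lemma fraction_extending (P : R -> R -> Prop) :
  (exists s r, S s /\ P s r) ->
  (forall a x y, P x y -> P (a * x) (a * y)) ->
  (forall x y y', P x y -> P x y' -> y = y') ->
  exists q : Q, forall x y, P x y -> action q x y.
Proof.
move=> [s [r [Ss Psr]]] PZ Pfun.
have hG : exists s0 r0, S s0 /\ fraction_graph s r = fraction_graph s0 r0.
  by exists s, r.
exists (exist _ _ hG : Q) => x y Pxy; have [c [a [Sc E]]] := ore_exch x Ss.
exists c, a; split=> //; apply: (Pfun (c * x)); first exact: PZ.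
by rewrite E; apply: PZ.
Qed.

Lemma ore_of_exists r : exists q : Q, forall x, action q x (x * r).
Proof.
have [||x _ _ -> ->//|q hq] := @fraction_extending (fun x y => y = x * r).
- by exists 1, (1 * r).
- by move=> a x _ ->; rewrite mulrA.
- by exists q => x; apply: hq.
Qed.

Lemma ore_opp_exists p : exists q : Q, forall x y,
  action p x y -> action q x (- y).
Proof.
have [||x y y' hy hy'|q hq] := @fraction_extending (fun x y => action p x (- y)).
- by have [s [r [Ss sr]]] := action_base p; exists s, (- r); rewrite opprK.
- by move=> a x y; rewrite -mulrN; apply: actionZ.
- by apply: oppr_inj; apply: action_fun hy hy'.
- by exists q => x y pxy; apply: hq; rewrite opprK.
Qed.

Lemma ore_add_exists p q : exists u : Q, forall x y z,
  action p x y -> action q x z -> action u x (y + z).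
Proof.
have [||x _ _ [y [z [py qz ->]]] [y' [z' [py' qz' ->]]]|u hu] :=
  @fraction_extending (fun x w => exists y z,
    [/\ action p x y, action q x z & w = y + z]).
- have [s [r [Ss sr]]] := action_base p; have [c [y [Sc cy]]] := action_dom q s.
  exists (c * s), (c * r + y); split; first exact: oreM.
  by exists (c * r), y; split=> //; apply: actionZ.
- move=> a x _ [y [z [py qz ->]]]; exists (a * y), (a * z).
  by split; [apply: actionZ|apply: actionZ|rewrite mulrDr].
- by rewrite (action_fun py py') (action_fun qz qz').
- by exists u => x y z py qz; apply: hu; exists y, z.
Qed.

Lemma ore_mul_exists p q : exists u : Q, forall x y z,
  action p x y -> action q y z -> action u x z.
Proof.
have [||x z z' [y [py qz]] [y' [py' qz']]|u hu] :=
  @fraction_extending (fun x z => exists y, action p x y /\ action q y z).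
- have [s [r [Ss sr]]] := action_base p; have [c [y [Sc cy]]] := action_dom q r.
  exists (c * s), y; split; first exact: oreM.
  by exists (c * r); split=> //; apply: actionZ.
- by move=> a x z [y [py qz]]; exists (a * y); split; apply: actionZ.
- by apply: action_fun qz _; rewrite (action_fun py py').
- by exists u => x y z py qz; apply: hu; exists y.
Qed.

Definition ore_of r : Q := sval (cid (ore_of_exists r)).
Definition ore_opp p : Q := sval (cid (ore_opp_exists p)).
Definition ore_add p q : Q := sval (cid (ore_add_exists p q)).
Definition ore_mul p q : Q := sval (cid (ore_mul_exists p q)).

Lemma action_of r x : action (ore_of r) x (x * r).
Proof. by rewrite /ore_of; case: cid => q; apply. Qed.

Lemma action_opp p x y : action p x y -> action (ore_opp p) x (- y).
Proof. by rewrite /ore_opp; case: cid => q; apply. Qed.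

Lemma action_add p q x y z :
  action p x y -> action q x z -> action (ore_add p q) x (y + z).
Proof. by rewrite /ore_add; case: cid => u; apply. Qed.

Lemma action_mul p q x y z :
  action p x y -> action q y z -> action (ore_mul p q) x z.
Proof. by rewrite /ore_mul; case: cid => u; apply. Qed.

Lemma action_base2 p q : exists s y z, [/\ S s, action p s y & action q s z].
Proof.
have [s [r [Ss sr]]] := action_base p; have [c [y [Sc cy]]] := action_dom q s.
exists (c * s), (c * r), y; split=> //; first exact: oreM.
exact: actionZ.
Qed.

Lemma action_base3 p q u : exists s x y z,
  [/\ S s, action p s x, action q s y & action u s z].
Proof.
have [s [x [y [Ss px qy]]]] := action_base2 p q.
have [c [z [Sc cz]]] := action_dom u s.
exists (c * s), (c * x), (c * y), z.
by split=> //; [apply: oreM | apply: actionZ | apply: actionZ].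
Qed.

HB.instance Definition _ := gen_eqMixin Q.
HB.instance Definition _ := gen_choiceMixin Q.

Lemma ore_addA : associative ore_add.
Proof.
move=> p q u; have [s [x [y [z [Ss px qy uz]]]]] := action_base3 p q u.
apply: (action_inj Ss); first by do 2![apply: action_add; eauto].
by rewrite addrA; do 2![apply: action_add => //].
Qed.

Lemma ore_addC : commutative ore_add.
Proof.
move=> p q; have [s [y [z [Ss py qz]]]] := action_base2 p q.
apply: (action_inj Ss (action_add py qz)); rewrite addrC; exact: action_add.
Qed.

Lemma ore_add0 : left_id (ore_of 0) ore_add.
Proof.
move=> p; have [s [y [Ss py]]] := action_base p.
apply: (action_inj Ss _ py); rewrite -(add0r y) -[X in X + _](mulr0 s).
by apply: action_add => //; apply: action_of.
Qed.

Lemma ore_addN : left_inverse (ore_of 0) ore_opp ore_add.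
Proof.
move=> p; have [s [y [Ss py]]] := action_base p.
apply: (action_inj Ss (action_add (action_opp py) py)).
by rewrite addNr -[X in action _ _ X](mulr0 s); apply: action_of.
Qed.

HB.instance Definition _ :=
  GRing.isZmodule.Build Q ore_addA ore_addC ore_add0 ore_addN.

(** A denominator [s] of [p * q]: both [s * p] and [s * p * q] lie in [R]. *)
Lemma action_base_mul p q : exists s y z, [/\ S s, action p s y & action q y z].
Proof.
have [s [r [Ss sr]]] := action_base p; have [c [y [Sc cy]]] := action_dom q r.
exists (c * s), (c * r), y; split=> //; first exact: oreM.
exact: actionZ.
Qed.

Lemma ore_mulA : associative ore_mul.
Proof.
move=> p q u; have [s [y [z [Ss py qz]]]] := action_base_mul p q.
have [c [w [Sc uw]]] := action_dom u z.
have Scs := oreM Sc Ss; have pcy := actionZ c py; have qcz := actionZ c qz.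
apply: (action_inj Scs (action_mul pcy (action_mul qcz uw))).
exact: action_mul (action_mul pcy qcz) uw.
Qed.

Lemma ore_mul1l : left_id (ore_of 1) ore_mul.
Proof.
move=> p; have [s [y [Ss py]]] := action_base p.
apply: (action_inj Ss _ py); apply: action_mul (action_of 1 s) _.
by rewrite mulr1.
Qed.

Lemma ore_mul1r : right_id (ore_of 1) ore_mul.
Proof.
move=> p; have [s [y [Ss py]]] := action_base p.
apply: (action_inj Ss _ py); apply: action_mul py _.
by rewrite -[X in action _ _ X]mulr1; apply: action_of.
Qed.

Lemma ore_mulDl : left_distributive ore_mul +%R.
Proof.
move=> p q u; have [s [y [z [Ss py qz]]]] := action_base2 p q.
have [c [y' [Sc uy]]] := action_dom u y.
have [d [z' [Sd uz]]] := action_dom u (c * z).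
have Sds : S (d * (c * s)) by do 2!apply: oreM => //.
have pd := actionZ d (actionZ c py); have qd := actionZ d (actionZ c qz).
have udy := actionZ d uy.
apply: (action_inj Sds (action_mul (action_add pd qd) (actionD udy uz))).
by apply: action_add; apply: action_mul; eauto.
Qed.

Lemma ore_mulDr : right_distributive ore_mul +%R.
Proof.
move=> p q u; have [s [y [z [Ss py qz]]]] := action_base_mul p q.
have [c [w [Sc uw]]] := action_dom u y.
have Scs := oreM Sc Ss; have pcy := actionZ c py; have qcz := actionZ c qz.
apply: (action_inj Scs (action_mul pcy (action_add qcz uw))).
by apply: action_add; apply: action_mul; eauto.
Qed.

HB.instance Definition _ := GRing.Zmodule_isPzRing.Build Q
  ore_mulA ore_mul1l ore_mul1r ore_mulDl ore_mulDr.

Lemma ore_ofB : zmod_morphism ore_of.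
Proof.
move=> x y; apply: (action_inj ore1 (action_of (x - y) 1)).
rewrite mulrBr; apply: action_add; first exact: action_of.
exact/action_opp/action_of.
Qed.

HB.instance Definition _ := GRing.isZmodMorphism.Build R Q ore_of ore_ofB.

Lemma ore_of_monoid : monoid_morphism ore_of.
Proof.
split=> // x y; apply: (action_inj ore1 (action_of (x * y) 1)).
rewrite mulrA; apply: action_mul; exact: action_of.
Qed.

HB.instance Definition _ := GRing.isMonoidMorphism.Build R Q ore_of ore_of_monoid.

Lemma ore_localization : is_left_localization S (ore_of : {rmorphism R -> Q}).
Proof.
split.
- split=> // r s Ss /(ore_rcancel Ss) ->; exists 1; rewrite ?mulr0 //.
- move=> s Ss.
  have hG : exists s0 r0, S s0 /\ fraction_graph s 1 = fraction_graph s0 r0.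
    by exists s, 1.
  pose u : Q := exist _ _ hG.
  have us : action u s 1 by exists 1, 1; rewrite !mul1r.
  have sE x : action (ore_of s) x (x * s) := action_of s x.
  exists u; split.
    apply: (action_inj Ss (action_mul us (sE 1))).
    by rewrite mul1r -[X in action _ _ X]mulr1; apply: action_of.
  apply: (@action_inj _ _ 1 1 ore1).
    by apply: action_mul (sE 1) _; rewrite mul1r.
  by rewrite -[X in action _ _ X]mulr1; apply: action_of.
- move=> q; have [s [r [Ss qsr]]] := action_base q; exists s, r; split=> //.
  apply: (action_inj ore1 (action_mul (action_of s 1) _)).
    by rewrite mul1r; exact: qsr.
  by rewrite -[X in action _ _ X]mul1r; apply: action_of.
- move=> r; split=> [r0|[s Ss sr0]].
    exists 1; rewrite // mul1r.
    apply: (@action_fun 0 1); last first.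
      by rewrite -[X in action _ _ X](mulr0 1); apply: (action_of 0).
    by rewrite -r0 -[X in action _ _ X]mul1r; apply: action_of.
  have -> : r = 0 by apply: (ore_lcancel Ss); rewrite sr0 mulr0.
  exact: rmorph0.
Qed.

End OreQuotient.

(** * Left localizations *)

Section Localization.
Variables (R : pzRingType) (S : set R).

Lemma invertible_mulI (Q : pzRingType) (u x y : Q) :
  invertible u -> u * x = u * y -> x = y.
Proof. by move=> [v [vu _]] E; rewrite -[x]mul1r -[y]mul1r -vu -!mulrA E. Qed.

(** The left denominator conditions are consequences of the other requirements
    on a localization: they express that [r s^-1] is a left fraction and that
    [s] can be cancelled. *)
Lemma localization_intro (Q : pzRingType) (f : {rmorphism R -> Q}) :
  multiplicative_set S ->
  (forall s, S s -> invertible (f s)) ->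
  (forall q : Q, exists s r : R, S s /\ f s * q = f r) ->
  (forall r : R, f r = 0 <-> ass S r) ->
  is_left_localization S f.
Proof.
move=> mS fS frac ker; split=> //; split; first split=> // r s Ss.
  have [v [vs sv]] := fS s Ss; have [c [r' [Sc E]]] := frac (f r * v).
  have /ker [d Sd dE] : f (c * r - r' * s) = 0.
    by rewrite rmorphB !rmorphM -E -!mulrA vs mulr1 subrr.
  have [_ SM _] := mS; exists (d * c), (d * r'); split; first exact: SM.
  by apply/eqP; rewrite -subr_eq0 -!mulrA -mulrBr dE.
move=> r s Ss rs0; apply/ker; have [v [_ sv]] := fS s Ss.
by rewrite -[f r]mulr1 -sv mulrA -rmorphM rs0 rmorph0 mul0r.
Qed.

Section Theory.
Variables (Q : pzRingType) (f : {rmorphism R -> Q}).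
Hypothesis loc : is_left_localization S f.
Implicit Types (s r c x : R) (p q : Q) (L M : set R).

Let SM s c : S s -> S c -> S (s * c).
Proof. by case: loc => -[[[_ + _] _] _] _ _ _; apply. Qed.
Let S1 : S 1. Proof. by case: loc => -[[[]]]. Qed.
Let exch r s : S s -> exists c a, S c /\ c * r = a * s.
Proof. by case: loc => -[[_ +] _] _ _ _; apply. Qed.
Let frac q : exists s r, S s /\ f s * q = f r.
Proof. by case: loc. Qed.
Let mulI s p q : S s -> f s * p = f s * q -> p = q.
Proof. by case: loc => _ fS _ _ /fS; apply: invertible_mulI. Qed.

Lemma common_denominator p q : exists s x y,
  [/\ S s, f s * p = f x & f s * q = f y].
Proof.
have [s [r [Ss sp]]] := frac p; have [t [u [St tq]]] := frac q.
have [c [a [Sc E]]] := exch s St.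
exists (c * s), (c * r), (a * u); split; first exact: SM.
  by rewrite !rmorphM -mulrA sp.
by rewrite E !rmorphM -mulrA tq.
Qed.

(** The extension [Q * f L] of a left ideal [L]. *)
Definition extension L : set Q :=
  [set q | exists s x, [/\ S s, L x & f s * q = f x]].

Lemma extension_image L x : L x -> extension L (f x).
Proof. by exists 1, x; rewrite rmorph1 mul1r. Qed.

Lemma left_ideal_extension L : is_left_ideal L -> is_left_ideal (extension L).
Proof.
case=> L0 LD LM; split.
- by rewrite -(rmorph0 f); apply: extension_image.
- move=> p q [s [x [Ss Lx sp]]] [t [y [St Ly tq]]].
  have [c [a [Sc E]]] := exch s St.
  exists (c * s), (c * x + a * y); split; first exact: SM.
    by apply: LD; apply: LM.
  by rewrite mulrDr rmorphD {2}E !rmorphM -!mulrA sp tq.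
- move=> p q [s [x [Ss Lx sq]]]; have [t [r [St tp]]] := frac p.
  have [c [a [Sc E]]] := exch r Ss.
  exists (c * t), (a * x); split; [exact: SM|exact: LM|].
  by rewrite rmorphM -!mulrA (mulrA (f t)) tp mulrA -rmorphM E !rmorphM -mulrA sq.
Qed.

Lemma left_ideal_preimage (I : set Q) :
  is_left_ideal I -> is_left_ideal (f @^-1` I).
Proof.
case=> I0 ID IM; split=> [|x y|r x] /=; rewrite ?rmorph0 ?rmorphD ?rmorphM //.
  exact: ID.
exact: IM.
Qed.

Lemma nonzero_fraction q :
  q <> 0 -> exists s r, [/\ S s, f s * q = f r & f r <> 0].
Proof.
move=> q0; have [s [r [Ss E]]] := frac q; exists s, r; split=> // r0.
by apply/q0/(mulI Ss); rewrite E r0 mulr0.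
Qed.

End Theory.

(** By the Ore condition, a single equation [s * q = r] with [s] in [S] decides
    for which [x] and [y] one has [x * q = y], and it does so in the same way in
    every localization. *)
Lemma localization_transfer (Q Q' : pzRingType) (f : {rmorphism R -> Q})
    (g : {rmorphism R -> Q'}) (q : Q) (q' : Q') s r :
  is_left_localization S f -> is_left_localization S g -> S s ->
  f s * q = f r -> g s * q' = g r ->
  forall x y, f x * q = f y -> g x * q' = g y.
Proof.
move=> [[[_ ore] _] _ _ kerf] [_ gS _ kerg] Ss fE gE x y E.
have [c [a [Sc ca]]] := ore x s Ss.
have /kerf /kerg : f (c * y - a * r) = 0.
  by rewrite rmorphB !rmorphM -E -fE !mulrA -!rmorphM ca subrr.
rewrite rmorphB => /eqP; rewrite subr_eq0 => /eqP ce.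
apply: (invertible_mulI (gS c Sc)).
by rewrite mulrA -!rmorphM ce ca !rmorphM -mulrA gE.
Qed.

(** A fraction of [Q] corresponds to the fraction of [Q'] that solves the same
    equations [x * q = y] over [R]. *)
Lemma localization_unique (Q Q' : pzRingType) (f : {rmorphism R -> Q})
    (g : {rmorphism R -> Q'}) :
  is_left_localization S f -> is_left_localization S g -> ring_isomorphic Q Q'.
Proof.
move=> locf locg.
have corr (A B : pzRingType) (h : {rmorphism R -> A}) (k : {rmorphism R -> B}) :
    is_left_localization S h -> is_left_localization S k ->
    forall q, exists q', forall x y, h x * q = h y -> k x * q' = k y.
  move=> loch lock q; have [_ _ /(_ q) [s [r [Ss hE]]] _] := loch.
  have [_ /(_ s Ss) [v [_ sv]] _ _] := lock.
  exists (v * k r); apply: (localization_transfer loch lock Ss hE).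
  by rewrite mulrA sv mul1r.
have [phi phiP] := choice (corr _ _ _ _ locf locg).
have [psi psiP] := choice (corr _ _ _ _ locg locf).
have [[[[_ SM _] ore] _] fS fracf _] := locf; have [_ gS fracg _] := locg.
have phiB : zmod_morphism phi.
  move=> p q; have [s [x [y [Ss px qy]]]] := common_denominator locf p q.
  apply: (invertible_mulI (gS s Ss)).
  rewrite mulrBr (phiP p _ x) // (phiP q _ y) // -rmorphB.
  by apply: phiP; rewrite mulrBr px qy rmorphB.
have phiM : monoid_morphism phi.
  split=> [|p q].
    rewrite -[LHS]mul1r -(rmorph1 g); apply: phiP.
    by rewrite rmorph1 mul1r.
  have [s [r [Ss sp]]] := fracf p; have [t [u [St tq]]] := fracf q.
  have [c [a [Sc E]]] := ore r t St.
  apply: (invertible_mulI (gS (c * s) (SM _ _ Sc Ss))).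
  transitivity (g (a * u)); last first.
    rewrite (rmorphM g c s) -mulrA (mulrA (g s)) (phiP p _ r) // mulrA.
    by rewrite -(rmorphM g c) E !rmorphM -mulrA (phiP q _ u).
  apply: phiP; rewrite rmorphM -!mulrA (mulrA (f s)) sp mulrA -rmorphM E.
  by rewrite !rmorphM -mulrA tq.
pose phi1 := GRing.isZmodMorphism.Build Q Q' phi phiB.
pose phi2 := GRing.isMonoidMorphism.Build Q Q' phi phiM.
pose phi' : {rmorphism Q -> Q'} := HB.pack phi phi1 phi2.
exists phi', psi => q.
  have [s [r [Ss E]]] := fracf q; apply: (invertible_mulI (fS s Ss)).
  by rewrite E; apply/psiP/phiP.
have [s [r [Ss E]]] := fracg q; apply: (invertible_mulI (gS s Ss)).
by rewrite E; apply/phiP/psiP.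
Qed.

(** If [a * t] is in [S], then [t^-1 r = (a t)^-1 (a r)]. *)
Lemma localization_dense (T : set R) (Q : pzRingType) (f : {rmorphism R -> Q}) :
  dense_subset S T -> is_left_localization T f -> is_left_localization S f.
Proof.
move=> [mS _ ST dense] [_ fT frac ker]; apply: localization_intro => //.
- by move=> s /ST /fT.
- move=> q; have [t [r [Tt E]]] := frac q; have [a Sat] := dense t Tt.
  by exists (a * t), (a * r); rewrite !rmorphM -mulrA E.
- move=> r; split=> [/ker [t Tt tr0]|[s Ss sr0]]; last first.
    by apply/ker; exists s => //; apply: ST.
  by have [a Sat] := dense t Tt; exists (a * t); rewrite // -mulrA tr0 mulr0.
Qed.

Lemma ass_ideal (Q : pzRingType) (f : {rmorphism R -> Q}) :
  is_left_localization S f -> is_ideal (ass S).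
Proof.
move=> [_ _ _ ker]; split=> [|r x /ker x0]; last first.
  by apply/ker; rewrite rmorphM x0 mul0r.
split=> [|x y /ker x0 /ker y0|r x /ker x0]; apply/ker.
- exact: rmorph0.
- by rewrite rmorphD x0 y0 addr0.
- by rewrite rmorphM x0 mulr0.
Qed.

End Localization.

Section Quotient.
Variables (R : pzRingType) (S : set R).
Hypothesis ha : is_ideal (ass S).

Lemma quot_map_eq0 x : quot_map ha x = 0 <-> ass S x.
Proof. by rewrite -(rmorph0 (quot_map ha)) quot_map_eq subr0. Qed.

Lemma localization_of_quotient (Q : pzRingType)
    (f : {rmorphism quot_ring ha -> Q}) :
  (forall s t, S s -> S t -> S (s * t)) -> S 1 ->
  is_left_localization (quot_map ha @` S) f ->
  is_left_localization S (f \o quot_map ha : {rmorphism R -> Q}).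
Proof.
move=> SM S1 [[[[_ _ nS0] _] _] fS frac ker]; apply: localization_intro => /=.
- by split=> // S0; apply: nS0; exists 0; rewrite ?rmorph0.
- by move=> s Ss; apply: fS; exists s.
- move=> q; have [_ [p [[s Ss <-] E]]] := frac q.
  by have [r rE] := quot_map_surj p; exists s, r; rewrite rE.
- move=> r; split=> [/ker [_ [s Ss <-]]|[s Ss sr0]].
    rewrite -rmorphM => /quot_map_eq0 [t St tsr0].
    by exists (t * s); rewrite ?mulrA -?mulrA //; apply: SM.
  by apply/ker; exists (quot_map ha s); [exists s|rewrite -rmorphM sr0 rmorph0].
Qed.

Lemma quotient_of_localization (Q : pzRingType) (f : {rmorphism R -> Q}) :
  is_left_localization S f -> exists g : {rmorphism quot_ring ha -> Q},
    is_left_localization (quot_map ha @` S) g /\ forall p, g p = 0 -> p = 0.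
Proof.
move=> [[[[S1 SM nS0] _] _] fS frac ker].
pose g (p : quot_ring ha) : Q := f (repr p).
have gE x : g (quot_map ha x) = f x.
  apply/eqP; rewrite -subr_eq0 -rmorphB; apply/eqP/ker/(quot_map_eq ha).
  by rewrite /quot_map reprK.
have gB : zmod_morphism g.
  move=> p q; have [x <-] := quot_map_surj p; have [y <-] := quot_map_surj q.
  by rewrite -rmorphB !gE rmorphB.
have gM : monoid_morphism g.
  split=> [|p q]; first by rewrite -(rmorph1 (quot_map ha)) gE rmorph1.
  have [x <-] := quot_map_surj p; have [y <-] := quot_map_surj q.
  by rewrite -rmorphM !gE rmorphM.
pose g1 := GRing.isZmodMorphism.Build _ _ g gB.
pose g2 := GRing.isMonoidMorphism.Build _ _ g gM.
pose g' : {rmorphism quot_ring ha -> Q} := HB.pack g g1 g2.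
have g0 p : g p = 0 -> p = 0.
  by have [x <-] := quot_map_surj p; rewrite gE => /ker /quot_map_eq0.
exists g'; split; last exact: g0.
apply: localization_intro.
- split; first by exists 1; rewrite ?rmorph1.
    move=> _ _ [s Ss <-] [t St <-]; exists (s * t); rewrite ?rmorphM //.
    exact: SM.
  move=> [s Ss /quot_map_eq0 [t St ts0]]; apply: nS0.
  by rewrite -ts0; apply: SM.
- by move=> _ [s Ss <-]; rewrite [g' _]gE; apply: fS.
- move=> q; have [s [r [Ss E]]] := frac q.
  exists (quot_map ha s), (quot_map ha r); split; first by exists s.
  by rewrite ![g' _]gE.
- move=> p; split=> [/g0 ->|[_ [s Ss <-]]].
    by exists 1; rewrite ?mulr0 //; exists 1; rewrite ?rmorph1.
  have [x <-] := quot_map_surj p; rewrite -rmorphM => /quot_map_eq0 [t St E].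
  by rewrite [g' _]gE; apply/ker; exists (t * s); rewrite -?mulrA //; apply: SM.
Qed.
End Quotient.

(** * Semisimple Artinian rings *)

Section Artinian.
Variable Q : pzRingType.
Implicit Types (L M N V W : set Q) (q u v : Q).

Lemma left_artinian_min (P : set (set Q)) : left_artinian Q ->
  (forall L, P L -> is_left_ideal L) -> P !=set0 ->
  exists2 L, P L & forall M, P M -> M `<=` L -> L `<=` M.
Proof.
move=> art Pideal [L0 PL0]; apply: contrapT => H.
have smaller L : exists M, P L -> [/\ P M, M `<=` L & ~ L `<=` M].
  have [PL|nPL] := pselect (P L); last by exists L.
  apply: contrapT => nM; apply: H; exists L => // M PM ML.
  by apply: contrapT => LM; apply: nM; exists M.
have [next nextP] := choice smaller.
pose chain n := iter n next L0.
have Pchain n : P (chain n) by elim: n => //= n /nextP [].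
have [k hk] : exists k, forall n, (k <= n)%N -> chain n = chain k.
  apply: art => n; first exact/Pideal/Pchain.
  by case: (nextP _ (Pchain n)).
by case: (nextP _ (Pchain k)) => _ _; rewrite [next _](hk k.+1 (leqnSn k)); apply.
Qed.

(** The chain of the [Q * u ^+ n] stops, and left regularity cancels the power
    of [u]: this gives [1 = q * u], and then [u * q = 1] by left regularity. *)
Lemma left_regular_invertible u :
  left_artinian Q -> left_regular Q u -> invertible u.
Proof.
move=> art ru.
have [|n|k hk] := art (fun n => principal (u ^+ n)).
- by move=> n; apply: left_ideal_principal.
- by move=> _ [r ->]; exists (r * u); rewrite exprS mulrA.
have ruk n q : q * u ^+ n = 0 -> q = 0.
  elim: n => [|n IH]; first by rewrite expr0 mulr1.
  by rewrite exprSr mulrA => /ru /IH.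
have : principal (u ^+ k.+1) (u ^+ k) by rewrite hk //; apply: mem_principal.
move=> [q qE]; have qu1 : 1 - q * u = 0.
  by apply: (ruk k); rewrite mulrBl mul1r -mulrA -exprS -qE subrr.
have {}qu1 : q * u = 1 by apply/esym/eqP; rewrite -subr_eq0 qu1.
exists q; split=> //; apply/eqP; rewrite -subr_eq0; apply/eqP/ru.
by rewrite mulrBl mul1r -mulrA qu1 mulr1 subrr.
Qed.

(** A complement of a sum of minimal left ideals, chosen as small as possible,
    is zero: a minimal left ideal inside it could be split off. *)
Lemma semisimple_uniform_sum : semisimple_artinian Q -> uniform_sum [set: Q].
Proof.
move=> [ss art].
pose P M := is_left_ideal M /\ exists W,
  [/\ uniform_sum W, W `&` M `<=` [set 0] & forall q, ideal_sum W M q].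
have [M [hM [W [sW WM0 WM]]] minM] : exists2 M, P M &
    forall N, P N -> N `<=` M -> M `<=` N.
  apply: left_artinian_min => // [L []//|]; exists setT; split=> //.
  exists [set 0]; split=> [|q []//|q]; first exact: uniform_sum0.
  by exists 0, q; rewrite add0r.
have hW := uniform_sum_left_ideal sW.
have [nM|/not_nonzero M0] := pselect (nonzero M); last first.
  suff <- : W = setT by [].
  apply/seteqP; split=> // q _; have [w [m [Ww /M0 -> ->]]] := WM q.
  by rewrite addr0.
have [V [hV nV VM] minV] : exists2 V,
    [/\ is_left_ideal V, nonzero V & V `<=` M] &
    forall N, [/\ is_left_ideal N, nonzero N & N `<=` M] -> N `<=` V -> V `<=` N.
  apply: (@left_artinian_min
    (fun V => [/\ is_left_ideal V, nonzero V & V `<=` M])) => // [L []//|].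
  by exists M; split.
have uV : uniform_left_ideal V.
  split=> // L N hL hN LV NV nL nN; case: nV => x [Vx x0].
  exists x; split=> //; split; apply: minV Vx => //; split=> //.
    exact: subset_trans LV VM.
  exact: subset_trans NV VM.
have [N [hN VN0 VN]] := ss V hV.
have hMN := left_idealI hM hN.
have WV0 : W `&` V `<=` [set 0] by move=> q [Wq /VM Mq]; apply: WM0.
have PMN : P (M `&` N).
  split=> //; exists (ideal_sum W V); split; first exact: uniform_sumS.
    move=> _ [[w [v [Ww Vv ->]]] [Mq Nq]].
    have w0 : w = 0.
      apply: WM0; split=> //; rewrite -(addrK v w).
      by apply: left_idealB => //; apply: VM.
    by rewrite -VN0; split; rewrite // w0 add0r // in Nq *.
  move=> q; have [w [m [Ww Mm ->]]] := WM q.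
  have [v [n [Vv Nn mE]]] := VN m.
  exists (w + v), n; split; [by exists w, v| |by rewrite mE addrA].
  split=> //; have -> : n = m - v by rewrite mE addrAC subrr add0r.
  by apply: left_idealB => //; apply: VM.
case: nV => x [Vx x0]; case: x0.
have [_ Nx] := minM _ PMN (@subIsetl _ M N) x (VM x Vx).
have : (V `&` N) x by [].
by rewrite VN0.
Qed.

End Artinian.

Lemma semisimple_artinian_isomorphic (A B : pzRingType) :
  ring_isomorphic A B -> semisimple_artinian A -> semisimple_artinian B.
Proof.
move=> [f [g fK gK]] [ss art].
have pre (L : set B) : is_left_ideal L -> is_left_ideal (f @^-1` L).
  case=> L0 LD LM; split=> [|x y|r x] /=; rewrite ?rmorph0 ?rmorphD ?rmorphM //.
    exact: LD.
  exact: LM.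
split=> [L hL|L hL dL].
  have [M [[M0 MD MM] LM0 LM]] := ss _ (pre L hL); exists (g @^-1` M).
  have gE b : exists2 a, b = f a & g b = a by exists (g b).
  have L0 : L 0 by case: hL.
  split.
  - split=> [|x y|r x] /=.
    + by rewrite -(rmorph0 f) fK.
    + by rewrite -{2}(gK x) -{2}(gK y) -rmorphD fK; apply: MD.
    + by rewrite -{1}(gK r) -{2}(gK x) -rmorphM fK; apply: MM.
  - apply/seteqP; split=> x /=; last first.
      by move=> ->; rewrite -{2}(rmorph0 f) fK.
    move=> [Lx Mx]; have : (f @^-1` L `&` M) (g x) by split; rewrite //= gK.
    by rewrite LM0 /= => gx0; rewrite -(gK x) gx0 rmorph0.
  - move=> b; have [x [y [Lx My E]]] := LM (g b).
    by exists (f x), (f y); rewrite /= fK -rmorphD -E gK.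
have [||k hk] := art (fun n => f @^-1` (L n)).
- by move=> n; apply: pre.
- by move=> n x /dL.
exists k => n kn; apply/seteqP.
have E x : (f @^-1` L n) (g x) = (f @^-1` L k) (g x) by rewrite hk.
by split=> x; have := E x; rewrite /preimage /= gK => ->.
Qed.

(** * Localizations that are semisimple Artinian *)

Section SemisimpleLocalization.
Variables (R : pzRingType) (S : set R) (Q : pzRingType) (f : {rmorphism R -> Q}).
Hypotheses (loc : is_left_localization S f) (ssQ : semisimple_artinian Q).
Implicit Types (x y r s t : R) (p q : Q) (A I L M V W : set R).

Let SM s t : S s -> S t -> S (s * t).
Proof. by case: loc => -[[[_ + _] _] _] _ _ _; apply. Qed.
Let exch r s : S s -> exists c a, S c /\ c * r = a * s.
Proof. by case: loc => -[[_ +] _] _ _ _; apply. Qed.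
Let frac q : exists s r, S s /\ f s * q = f r.
Proof. by case: loc. Qed.
Let ker r : f r = 0 <-> ass S r.
Proof. by case: loc. Qed.
Let mulI s p q : S s -> f s * p = f s * q -> p = q.
Proof. by case: loc => _ fS _ _ /fS; apply: invertible_mulI. Qed.
Let mulI0 s q : S s -> f s * q = 0 -> q = 0.
Proof. by move=> Ss E; apply: (mulI Ss); rewrite E mulr0. Qed.

(** The extension of a two-sided ideal is two-sided. Only right multiplication
    by the inverse [v] of some [f s] is in question. The left ideals of those
    [q] with [q * v ^+ n] in the extension decrease with [n], and stability at
    [n] says that the extension is closed under multiplication by [v]. *)
Lemma ideal_extension I : is_ideal I -> is_ideal (extension S f I).
Proof.
move=> [hI IR]; have hL := left_ideal_extension loc hI.
set L := extension S f I in hL *; split=> //.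
have Lf q r : L q -> L (q * f r).
  move=> [s [x [Ss Ix E]]]; exists s, (x * r); split=> //; first exact: IR.
  by rewrite mulrA E rmorphM.
have Lv s v q : v * f s = 1 -> f s * v = 1 -> L q -> L (q * v).
  move=> vs sv Lq.
  have [|n|k hk] := ssQ.2 (fun n => [set q | L (q * v ^+ n)]).
  - by move=> n; apply: left_ideal_colon.
  - by move=> p /= /(Lf _ s); rewrite exprSr -!mulrA vs mulr1.
  have comm : GRing.comm (f s) v by rewrite /GRing.comm sv vs.
  have svk : f s ^+ k * v ^+ k = 1 by rewrite -exprMn_comm // sv expr1n.
  have : [set q | L (q * v ^+ k.+1)] (q * f s ^+ k).
    by rewrite hk //= -mulrA svk mulr1.
  by rewrite /= exprSr -mulrA (mulrA (f s ^+ k)) svk mul1r.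
move=> p q Lq; have [s [r [Ss E]]] := frac p.
have [_ /(_ s Ss) [v [vs sv]] _ _] := loc.
by rewrite -[p]mul1r -vs -mulrA E mulrA; apply/Lf/(Lv s).
Qed.

(** If [A] has square zero modulo [ass S], then the extension of [A], being
    two-sided, has square zero; and a left ideal with square zero that is a
    direct summand is zero. *)
Lemma semiprime_ass : semiprime_ideal (ass S).
Proof.
split=> [|A hA AA]; first exact: ass_ideal loc.
have [hL LQ] := ideal_extension hA; set L := extension S f A in hL LQ.
have LL p q : L p -> L q -> p * q = 0.
  move=> Lp [s [y [Ss Ay E]]].
  have [_ /(_ s Ss) [v [vs sv]] _ _] := loc.
  have [t [x [St Ax tE]]] := LQ v p Lp; apply: (mulI0 St).
  rewrite -[q]mul1r -vs -mulrA E (mulrA p) mulrA tE -rmorphM.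
  by apply/ker/AA.
have [M [hM LM0 LM]] := ssQ.1 L hL; have [l [m [Ll Mm E1]]] := LM 1.
move=> x Ax; have Lx : L (f x) by apply: extension_image loc _ _ Ax.
apply/ker; have fE : f x = f x * m.
  by rewrite -[LHS]mulr1 E1 mulrDr (LL _ _ Lx Ll) add0r.
have : (L `&` M) (f x) by split=> //; rewrite fE; case: hM => _ _; apply.
by rewrite LM0.
Qed.

(** Let [Q] be simple and [A B] contained in [ass S]. The extension of [A] is
    zero or contains [1]; in the second case [f A] contains a unit, so that
    [f B] is zero.

    Conversely let [I] be a nonzero ideal of [Q], with complement [M]. Then
    [I * M] is in [I] and in [M], hence zero, so that primeness forces the
    preimage of the right annihilator of [I], and then [M], to be zero. *)
Lemma simple_localizationP : simple_ring Q <-> prime_ideal (ass S).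
Proof.
have hass := ass_ideal loc; split.
  move=> [Q1 simple]; split=> // [/ker|A B hA hB AB].
    by rewrite rmorph1.
  have [E|E] := simple _ (ideal_extension hA).
    left=> x Ax; apply/ker.
    by have : [set 0] (f x) by rewrite -E; apply: extension_image loc _ _ Ax.
  right=> y By; have : extension S f A 1 by rewrite E.
  move=> [s [x [Ss Ax]]]; rewrite mulr1 => sx; apply/ker/(mulI0 Ss).
  by rewrite sx -rmorphM; apply/ker/AB.
move=> [_ n1 prime]; split=> [Q1|I [hI IQ]].
  by apply/n1/ker; rewrite rmorph1.
pose ann : set Q := [set q | forall p, I p -> p * q = 0].
have pre (J : set Q) : is_ideal J -> is_ideal (f @^-1` J).
  move=> [hJ JQ]; split; first exact: left_ideal_preimage.
  by move=> r x /= Jx; rewrite rmorphM; apply: JQ.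
have hann : is_ideal ann.
  split; first split=> /= [p|x y hx hy p Ip|r x hx p Ip].
  - by rewrite mulr0.
  - by rewrite mulrDr hx // hy // addr0.
  - by rewrite mulrA hx //; apply: IQ.
  by move=> r x hx p Ip; rewrite mulrA hx // mul0r.
have zero (J : set Q) : is_left_ideal J -> f @^-1` J `<=` ass S -> J `<=` [set 0].
  move=> [_ _ JM] J0 q Jq; have [s [r [Ss E]]] := frac q.
  by apply: (mulI0 Ss); rewrite E; apply/ker/J0; rewrite /= -E; apply: JM.
have [|I0|ann0] := prime _ _ (pre I (conj hI IQ)) (pre ann hann).
- by move=> x y /= Ix /(_ _ Ix) E; apply/ker; rewrite rmorphM.
- by left; apply/seteqP; split=> [|_ ->]; [exact: zero|case: hI].
right; apply/seteqP; split=> // q _.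
have [M [hM IM0 IM]] := ssQ.1 I hI; have [i [m [Ii Mm ->]]] := IM q.
suff -> : m = 0 by rewrite addr0.
apply: (zero ann) => // [|p Ip]; first by case: hann.
suff : (I `&` M) (p * m) by rewrite IM0.
by split; [apply: IQ|case: hM => _ _; apply].
Qed.

(** From here on [R] is a subring of [Q]. *)
Hypothesis injf : forall x, f x = 0 -> x = 0.

Let f_inj x y : f x = f y -> x = y.
Proof.
move/eqP; rewrite -subr_eq0 -rmorphB => /eqP /injf /eqP.
by rewrite subr_eq0 => /eqP.
Qed.

(** Left regularity passes from [R] to [Q] by clearing denominators on the left;
    in an Artinian ring it means invertibility. *)
Lemma left_regular_fraction_unit t : left_regular R t -> invertible (f t).
Proof.
move=> rt; apply: left_regular_invertible ssQ.2 _ => q qt0.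
have [s [r [Ss E]]] := frac q; apply: (mulI0 Ss).
have rt0 : r * t = 0 by apply: injf; rewrite rmorphM -E -mulrA qt0 mulr0.
by rewrite E (rt _ rt0) rmorph0.
Qed.

(** For a left regular [t], clearing the denominator of the inverse of [f t]
    gives [r] with [r * t] in [S]. *)
Lemma dense_left_regular : dense_subset S (left_regular R).
Proof.
have [[[mS _] _] fS _ _] := loc; have [S1 _ nS0] := mS.
split=> //.
- split=> [x|s t rs rt x|r0]; first by rewrite mulr1.
    by rewrite mulrA => /rt /rs.
  by apply: nS0; rewrite -(r0 1) // mulr0.
- move=> s /fS [v [_ sv]] x xs0; apply: injf.
  by rewrite -[f x]mulr1 -sv mulrA -rmorphM xs0 rmorph0 mul0r.
- move=> t /left_regular_fraction_unit [v [vt _]].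
  have [s [r [Ss E]]] := frac v; exists r.
  suff -> : r * t = s by [].
  by apply: f_inj; rewrite rmorphM -E -mulrA vt mulr1.
Qed.

Lemma extension_nonzero L : nonzero L -> nonzero (extension S f L).
Proof.
move=> [x [Lx x0]]; exists (f x); split; first exact: extension_image loc _ _ Lx.
by move/injf.
Qed.

(** Two nonzero left ideals below [f @^-1` V] have extensions inside [V], and a
    common element of the extensions becomes, after multiplication by an element
    of [S], a common element of the left ideals themselves. *)
Lemma uniform_preimage (V : set Q) :
  uniform_left_ideal V -> uniform_left_ideal (f @^-1` V).
Proof.
move=> [hV [v [Vv v0]] H]; have [_ _ VM] := hV; split.
- exact: left_ideal_preimage.
- have [s [r [Ss E r0]]] := nonzero_fraction loc v0; exists r; split.
    by rewrite /= -E; apply: VM.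
  by move=> r00; apply: r0; rewrite r00 rmorph0.
move=> L M hL hM LV MV nL nM.
have sub N : N `<=` f @^-1` V -> extension S f N `<=` V.
  move=> NV q [s [x [Ss /NV Vx E]]].
  have [_ /(_ s Ss) [u [us _]] _ _] := loc.
  by rewrite -[q]mul1r -us -mulrA E; apply: VM.
have [q [[[s [x [Ss Lx sE]]] [t [y [St My tE]]]] q0]] := H _ _
  (left_ideal_extension loc hL) (left_ideal_extension loc hM)
  (sub _ LV) (sub _ MV) (extension_nonzero nL) (extension_nonzero nM).
have [c [a [Sc E]]] := exch s St.
have cx_ay : c * x = a * y.
  by apply: f_inj; rewrite !rmorphM -sE -tE !mulrA -!rmorphM E.
exists (c * x); split.
  split; first by case: hL => _ _; apply.
  by rewrite cx_ay; case: hM => _ _; apply.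
by move=> cx0; apply/q0/(mulI0 Ss)/(mulI0 Sc); rewrite sE -rmorphM cx0 rmorph0.
Qed.

(** The preimage of a sum can exceed the sum of the preimages, which is
    therefore related to [W] by its extension only. *)
Lemma uniform_sum_preimage (W : set Q) : uniform_sum W -> exists W',
  [/\ uniform_sum W', W' `<=` f @^-1` W & W `<=` extension S f W'].
Proof.
elim=> [|{}W V sW [W' [sW' W'W WW']] uV WV].
  exists [set 0]; split; first exact: uniform_sum0.
    by move=> _ ->; rewrite /= rmorph0.
  by move=> _ ->; case: (left_ideal_extension loc (@left_ideal0 R)).
have hV : is_left_ideal V by case: uV.
have hW' := uniform_sum_left_ideal sW'; have hV' := left_ideal_preimage f hV.
exists (ideal_sum W' (f @^-1` V)); split.
- apply: uniform_sumS => //; first exact: uniform_preimage.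
  by move=> x [/W'W Wx Vx]; apply/injf/WV.
- move=> _ [x [y [/W'W Wx Vy ->]]]; rewrite /= rmorphD.
  by exists (f x), (f y).
move=> _ [w [v [/WW' [s [x [Ss Wx sE]]] Vv ->]]].
have hE := left_ideal_extension loc (left_ideal_sum hW' hV').
have [_ ED _] := hE; apply: ED.
  by exists s, x; split=> //; apply: sub_ideal_suml.
have [t [y [St tE]]] := frac v; exists t, y; split=> //.
apply: sub_ideal_sumr => //=; rewrite -tE.
by case: hV => _ _; apply.
Qed.

(** If the extension of [W] is [Q], then [W] meets [S]; and a left ideal that
    meets [S] is essential by the Ore condition. *)
Lemma finite_udim_localization : finite_left_udim R.
Proof.
have [W [sW _ QW]] := uniform_sum_preimage (semisimple_uniform_sum ssQ).
apply/finite_left_udimP; exists W => //.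
have hW := uniform_sum_left_ideal sW; apply/essentialP; split=> // x x0.
have [s [y [Ss Wy]]] := QW 1 I; rewrite mulr1 => /f_inj sy.
have [c [a [Sc E]]] := exch x Ss; exists c; split.
  by rewrite E sy; case: hW => _ _; apply.
by move=> cx0; apply/x0/injf/(mulI0 Sc); rewrite -rmorphM cx0 rmorph0.
Qed.

(** A left ideal with square zero lies in its left annihilator [J], which is
    two-sided; so it lies in [J] and in the right annihilator [K] of [J]. The
    intersection of [J] and [K] is an ideal with square zero, hence zero. *)
Lemma semiprime_left_ideal V : is_left_ideal V ->
  (forall x y, V x -> V y -> x * y = 0) -> V `<=` [set 0].
Proof.
move=> [V0 VD VM] VV.
pose J := [set x | forall y, V y -> x * y = 0].
pose K := [set y | forall x, J x -> x * y = 0].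
have JR r x : J x -> J (x * r) by move=> Jx y Vy; rewrite -mulrA Jx //; apply: VM.
have hJK : is_ideal (J `&` K).
  split; last first.
    move=> r x [Jx Kx]; split; first exact: JR.
    by move=> z Jz; rewrite mulrA Kx ?mul0r.
  split.
  - by split=> x _; rewrite ?mul0r ?mulr0.
  - move=> x y [Jx Kx] [Jy Ky]; split=> z hz.
      by rewrite mulrDl Jx // Jy // addr0.
    by rewrite mulrDr Kx // Ky // addr0.
  - move=> r x [Jx Kx]; split=> z hz; first by rewrite -mulrA Jx // mulr0.
    by rewrite mulrA Kx //; apply: JR.
have [_ /(_ _ hJK) H] := semiprime_ass.
move=> x Vx; apply/injf/ker/H; last by split=> y; [exact: VV|apply].
by move=> y z [Jy _] [_ Kz]; apply/ker; rewrite Kz ?rmorph0.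
Qed.

(** For uniform [V] and a nonzero left ideal [K] of [V], a complement of
    [Q * f K] cannot meet [V]; so [V] lies in [Q * f K]. Hence if [v] in [V]
    kills a nonzero element of [V] from the right, then it kills [V]. This
    fails for some [v], as [V] does not have square zero. *)
Lemma left_regular_in_uniform V :
  uniform_left_ideal V -> left_regular_in V !=set0.
Proof.
move=> [hV nV uV]; have [_ _ VM] := hV.
have [w [v [Vw Vv wv0]]] : exists w v, [/\ V w, V v & w * v <> 0].
  apply: contrapT => H; case: nV => x [Vx]; apply.
  apply: (semiprime_left_ideal hV) => // y z Vy Vz.
  by apply: contrapT => yz0; apply: H; exists y, z.
exists v; split=> // x y Vx Vy xyv; apply: contrapT => xy.
pose K := V `&` left_ann v; have hK : is_left_ideal K.
  exact: left_idealI hV (left_ideal_ann v).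
have nK : nonzero K.
  exists (x - y); split; last by move/eqP; rewrite subr_eq0 => /eqP.
  split; first exact: left_idealB.
  by rewrite /left_ann /= mulrBl xyv subrr.
have hE := left_ideal_extension loc hK; have [M [hM EM0 EM]] := ssQ.1 _ hE.
have VM0 : V `&` f @^-1` M `<=` [set 0].
  apply: not_nonzero => nVM.
  have [z [[Kz [Vz Mz]] z0]] := uV _ _ hK (left_idealI hV (left_ideal_preimage f hM))
    (@subIsetl _ _ _) (@subIsetl _ _ _) nK nVM.
  apply/z0/injf; have : (extension S f K `&` M) (f z).
    by split=> //; apply: extension_image loc _ _ Kz.
  by rewrite EM0.
have [k [m [[s [z [Ss [Vz zv0] kE]]] Mm wE]]] := EM (f w).
have sw : s * w = z.
  apply/eqP; rewrite -subr_eq0; apply/eqP/VM0; split.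
    by apply: left_idealB => //; apply: VM.
  rewrite /= rmorphB rmorphM wE mulrDr kE addrAC subrr add0r.
  by case: hM => _ _; apply.
by apply/wv0/injf/(mulI0 Ss); rewrite -rmorphM mulrA sw zv0 rmorph0.
Qed.

End SemisimpleLocalization.

(** * Goldie's theorem *)

Section ClassicalQuotient.
Variables (R : pzRingType) (Q : pzRingType) (f : {rmorphism R -> Q}).
Hypotheses (loc : is_left_localization (regular R) f)
  (udimR : finite_left_udim R)
  (regular_in_uniform :
     forall V : set R, uniform_left_ideal V -> left_regular_in V !=set0).

Let injf x : f x = 0 -> x = 0.
Proof. by have [_ _ _ ker] := loc => /ker [s [_ rs] /rs]. Qed.

(** A complement [M] up to essentiality of the preimage of [L] extends to a
    complement of [L]: the sum contains a regular element of [R], and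
    regular elements are units of [Q]. *)
Lemma classical_quotient_semisimple : left_semisimple Q.
Proof.
move=> L hL; have [_ _ LM] := hL; have [_ fS frac _] := loc.
have [M [hM LM0 eLM]] := essential_complement (left_ideal_preimage f hL).
have hE := left_ideal_extension loc hM; exists (extension (regular R) f M).
split=> //.
  apply/seteqP; split=> [q [Lq [s [x [Ss Mx E]]]]|_ ->]; last first.
    by split; [case: hL|case: hE].
  apply: (invertible_mulI (fS s Ss)); rewrite mulr0 E.
  by rewrite [x]LM0 ?rmorph0 //; split=> //=; rewrite -E; apply: LM.
have [c [x [y [Lx My cE]]] rc] := essential_regular regular_in_uniform udimR eLM.
have [v [vc _]] := fS c rc.
move=> q; exists (q * v * f x), (q * v * f y); split.
- exact: LM.
- by case: hE => _ _; apply; apply: extension_image loc _ _ My.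
- by rewrite -mulrDr -rmorphD -cE -mulrA vc mulr1.
Qed.

(** In a strictly decreasing chain of left ideals of [Q] every term has a
    nonzero left ideal disjoint from the next term. This gives an infinite
    independent sequence in [R]. *)
Lemma classical_quotient_artinian : left_artinian Q.
Proof.
move=> L hL dL; apply: contrapT => H; have [_ _ frac _] := loc.
have dL' m n : (m <= n)%N -> L n `<=` L m.
  by move=> /subnK <-; elim: (n - m)%N => [//|k IH] q /dL /IH.
have jump k : exists n, (k <= n)%N /\ L n <> L k.
  apply: contrapT => Hk; apply: H; exists k => n kn.
  by apply: contrapT => Ln; apply: Hk; exists n.
have [next nextP] := choice jump.
pose N i := L (iter i next 0%N).
have pick i : exists x, [/\ N i (f x), x <> 0 &
    forall t, N i.+1 (f (t * x)) -> t * x = 0].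
  set k := iter i next 0%N; have [kn Lnk] := nextP k.
  have [q Lq Lq'] : exists2 q, L k q & ~ L (next k) q.
    apply: contrapT => Hq; apply: Lnk; apply/seteqP; split; first exact: dL'.
    by move=> q Lq; apply: contrapT => Lq'; apply: Hq; exists q.
  have [M [hM LM0 LM]] := classical_quotient_semisimple (hL (next k)).
  have [l [m [Ll Mm qE]]] := LM q.
  have Lm : L k m.
    have -> : m = q - l by rewrite qE addrAC subrr add0r.
    by apply: left_idealB => //; apply: dL' Ll.
  have m0 : m <> 0 by move=> m0; apply: Lq'; rewrite qE m0 addr0.
  have [s [x [Ss E x0]]] := nonzero_fraction loc m0.
  have Mx : M (f x) by rewrite -E; case: hM => _ _; apply.
  exists x; split.
  - by rewrite /N -/k -E; case: (hL k) => _ _; apply.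
  - by move=> x00; apply: x0; rewrite x00 rmorph0.
  - move=> t Nt; apply: injf; have : (L (next k) `&` M) (f (t * x)).
      by split=> //; rewrite rmorphM; case: hM => _ _; apply.
    by rewrite LM0.
have [x xP] := choice pick.
have Nle i j : (i <= j)%N -> N j `<=` N i.
  move=> /subnK <-; elim: (j - i)%N => [//|n IH] q Nq; apply: IH.
  by apply: dL' Nq; case: (nextP (iter (n + i) next 0%N)).
have ind m n (t : nat -> R) : \sum_(k < n) t k * x (m + k)%N = 0 ->
    forall k, (k < n)%N -> t k * x (m + k)%N = 0.
  elim: n m t => [//|n IH] m t; rewrite big_ord_recl addn0 => t0.
  have tail : \sum_(i < n) t (lift ord0 i) * x (m + lift ord0 i)%N =
              \sum_(i < n) t i.+1 * x (m.+1 + i)%N.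
    by apply: eq_bigr => i _; rewrite /= /bump /= add1n addSnnS.
  have tx0 : t 0%N * x m = 0.
    case: (xP m) => _ _; apply.
    have -> : t 0%N * x m = - \sum_(i < n) t i.+1 * x (m.+1 + i)%N.
      by apply/eqP; rewrite -tail -addr_eq0 t0.
    rewrite rmorphN; apply: left_idealN; first exact: hL.
    rewrite rmorph_sum; have [N0 ND NM] := hL (iter m.+1 next 0%N).
    elim/big_ind: _ => [//|//|i _]; rewrite rmorphM; apply: NM.
    by apply: (Nle m.+1 (m.+1 + i)%N (leq_addr _ _)); case: (xP (m.+1 + i)%N).
  move: t0; rewrite tx0 add0r tail => t0 [_|k kn]; first by rewrite addn0.
  by rewrite -addSnnS; apply: (IH m.+1 (fun k => t k.+1)).
apply: (finite_udim_independent (x := x) udimR).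
  by move=> n t; apply: (ind 0%N).
by move=> k; case: (xP k).
Qed.

End ClassicalQuotient.

(** * The equivalence *)

Theorem theorem1p1 (R : pzRingType) :
  let C : set R := left_regular R in
  let a : set R := ass C in
  let stmt1 := left_localization_has C semisimple_artinian in
  let stmt2 := exists ha : is_ideal a,
    let Rbar : pzRingType := quot_ring ha in
    let Cbar : set Rbar := quot_map ha @` C in
    [/\ semiprime_ideal a,
        dense_subset Cbar (left_regular Rbar),
        finite_left_udim Rbar
      & forall V : set Rbar, uniform_left_ideal V ->
          left_regular_in V !=set0] in
  let stmt3 := exists ha : is_ideal a,
    let Rbar : pzRingType := quot_ring ha in
    let Cbar : set Rbar := quot_map ha @` C in
    [/\ semiprime_ideal a,
        dense_subset Cbar (regular Rbar)
      & left_localization_has (regular Rbar) semisimple_artinian] in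
  [/\ stmt1 <-> stmt2,
      stmt2 <-> stmt3
    & stmt1 \/ stmt2 \/ stmt3 ->
      exists ha : is_ideal a,
        let Rbar : pzRingType := quot_ring ha in
        let Cbar : set Rbar := quot_map ha @` C in
        [/\ left_den [set 0] Cbar,
            dense_subset Cbar (regular Rbar),
            [/\ left_localization_has C (fun=> True),
                left_localization_has Cbar (fun=> True)
              & left_localization_has (regular Rbar) (fun=> True)],
            forall (Q Q1 Q2 : pzRingType) (f : {rmorphism R -> Q})
                (f1 : {rmorphism Rbar -> Q1}) (f2 : {rmorphism Rbar -> Q2}),
              is_left_localization C f ->
              is_left_localization Cbar f1 ->
              is_left_localization (regular Rbar) f2 ->
              ring_isomorphic Q Q1 /\ ring_isomorphic Q1 Q2
          & forall (Q : pzRingType) (f : {rmorphism R -> Q}),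
              is_left_localization C f ->
              (simple_ring Q <-> prime_ideal a)]].
Proof.
move=> C a stmt1 stmt2 stmt3.
have C1 : C 1 by move=> x; rewrite mulr1.
have CM s t : C s -> C t -> C (s * t) by move=> Cs Ct x; rewrite mulrA => /Ct /Cs.
have pull (ha : is_ideal a) (Q : pzRingType) (f : {rmorphism quot_ring ha -> Q}) :
    is_left_localization (quot_map ha @` C) f ->
    is_left_localization C (f \o quot_map ha : {rmorphism R -> Q}).
  exact: localization_of_quotient.
have s12 : stmt1 -> stmt2.
  move=> [Q [f [loc ssQ]]]; have ha := ass_ideal loc; exists ha.
  have [g [locg injg]] := quotient_of_localization ha loc; split.
  - exact: semiprime_ass loc ssQ.
  - exact: dense_left_regular locg ssQ injg.
  - exact: finite_udim_localization locg ssQ injg.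
  - exact: left_regular_in_uniform locg ssQ injg.
have s23 : stmt2 -> stmt3.
  move=> [ha [sp dense udim reg_in]]; exists ha.
  have [_ mult _ _] := dense.
  rewrite (left_regular_regular reg_in udim) in dense mult.
  have ore := regular_left_ore reg_in udim mult.
  have reg : regular (quot_ring ha) `<=` regular (quot_ring ha) by [].
  have loc := ore_localization ore reg.
  split=> //; exists (ore_quot ore reg), (@ore_of _ _ ore reg).
  split=> //; split; first exact: classical_quotient_semisimple loc udim reg_in.
  exact: classical_quotient_artinian loc udim reg_in.
have s31 : stmt3 -> stmt1.
  move=> [ha [sp dense [Q [f [loc ssQ]]]]].
  exists Q, (f \o quot_map ha); split=> //.
  exact: pull (localization_dense dense loc).
split; [by split=> // /s23 /s31|by split=> // /s31 /s12|].
move=> H; have {H} : stmt3 by case: H => [/s12 /s23|[/s23|]].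
move=> H; have [Q0 [f0 [loc0 ss0]]] := s31 H.
move: H => [ha [sp dense [Q' [f' [loc' ss']]]]]; exists ha.
have locbar := localization_dense dense loc'.
split=> //.
- have [den _ _ ker] := locbar; split=> //.
  have [_ _ _ ker'] := loc'.
  apply/seteqP; split=> [p /ker /ker' [s [_ rs] /rs]|_ ->] //.
  by apply/ker; rewrite rmorph0.
- by split; [exists Q0, f0|exists Q', f'|exists Q', f'].
- move=> Q Q1 Q2 f f1 f2 loc loc1 loc2; split.
    exact: localization_unique loc (pull ha Q1 f1 loc1).
  exact: localization_unique loc1 (localization_dense dense loc2).
- move=> Q f loc; apply: (simple_localizationP loc).
  exact: semisimple_artinian_isomorphic (localization_unique loc0 loc) ss0.
Qed.
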